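(* Let $M \in \mathcal{M}_{3,2}^{p \times q}$ and let $A^{(1)},\dots,A^{(p)},B^{(1)},\dots,B^{(q)}\in\mathcal{S}_+^2$ be a size-$2$ psd factorization of $M$. Let $A^{(1)},\dots,A^{(\bar p)},B^{(1)},\dots,B^{(\bar q)}$ be the collection of the factors that have rank one, and for these write $A^{(i)}=a_ia_i^T$, $B^{(j)}=b_jb_j^T$ with $a_i,b_j\in\mathbb{R}^2$. Assume that $\det(a_i,a_j)\neq0$ for all $i\neq j$, $\det(b_i,b_j)\ne0$ for all $i\ne j$, and $\langle a_i,b_j\rangle\neq0$ for all $i\in\{1,\dots,\bar p\}$, $j\in\{1,\dots,\bar q\}$. Then for each $s\in\{1,2\}$ the factorization is $s$-infinitesimally rigid if and only if there exist factors of rank one $A^{(i_1)},A^{(i_2)},A^{(i_3)},B^{(j_1)},B^{(j_2)},B^{(j_3)}$ (with $i_1,i_2,i_3$ pairwise distinct and $j_1,j_2,j_3$ pairwise distinct) such that $$\frac{\det(b_{j_1},b_{j_3})\det(b_{j_2},b_{j_3})\langle a_{i_2},b_{j_3} \rangle \langle a_{i_3},b_{j_3} \rangle}{\det(a_{i_1},a_{i_2})\det(a_{i_1},a_{i_3})\langle a_{i_1},b_{j_1} \rangle \langle a_{i_1},b_{j_2} \rangle} >0,$$ $$-\frac{\det(b_{j_1},b_{j_3})\det(b_{j_2},b_{j_3})\langle a_{i_1},b_{j_3} \rangle \langle a_{i_3},b_{j_3} \rangle}{\det(a_{i_1},a_{i_2})\det(a_{i_2},a_{i_3})\langle a_{i_2},b_{j_1}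 \rangle \langle a_{i_2},b_{j_2} \rangle} >0,$$ $$\frac{\det(b_{j_1},b_{j_3})\det(b_{j_2},b_{j_3})\langle a_{i_1},b_{j_3} \rangle \langle a_{i_2},b_{j_3} \rangle}{\det(a_{i_1},a_{i_3})\det(a_{i_2},a_{i_3})\langle a_{i_3},b_{j_1} \rangle \langle a_{i_3},b_{j_2} \rangle} >0,$$ $$\frac{\det(b_{j_2},b_{j_3}) \langle a_{i_1},b_{j_3} \rangle \langle a_{i_2},b_{j_3} \rangle \langle a_{i_3},b_{j_3} \rangle}{\det(b_{j_1},b_{j_2})\langle a_{i_1},b_{j_1} \rangle \langle a_{i_2},b_{j_1} \rangle \langle a_{i_3},b_{j_1} \rangle} >0,$$ $$-\frac{\det(b_{j_1},b_{j_3}) \langle a_{i_1},b_{j_3} \rangle \langle a_{i_2},b_{j_3} \rangle \langle a_{i_3},b_{j_3} \rangle}{\det(b_{j_1},b_{j_2})\langle a_{i_1},b_{j_2} \rangle \langle a_{i_2},b_{j_2} \rangle \langle a_{i_3},b_{j_2} \rangle} >0.$$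
   Context: $\mathcal{S}^2$ (resp. $\mathcal{S}^2_+$) is the set of real symmetric (resp. symmetric positive semidefinite, psd) $2\times2$ matrices; $\langle X,Y\rangle=\operatorname{trace}(XY)$ for symmetric matrices, $\langle a,b\rangle=a^Tb$ for vectors; $\det(a,b)$ is the determinant of the $2\times2$ matrix with columns $a,b$. A size-$k$ psd factorization of a nonnegative $p\times q$ matrix $M$ is a tuple $A^{(1)},\dots,A^{(p)},B^{(1)},\dots,B^{(q)}$ of $k\times k$ psd matrices with $M_{ij}=\langle A^{(i)},B^{(j)}\rangle$; the psd rank of $M$ is the smallest such $k$. $\mathcal{M}_{3,2}^{p\times q}$ is the set of nonnegative $p\times q$ matrices of rank $3$ and psd rank $2$. For $s\in\{1,2\}$, an $s$-infinitesimal motion of a size-$2$ psd factorization is a tuple $(\dot A^{(1)},\dots,\dot A^{(p)},\dot B^{(1)},\dots,\dot B^{(q)})$ of matrices in $\mathcal{S}^2$ such that (1) $\langle\dot A^{(i)},B^{(j)}\rangle+\langle A^{(i)},\dot B^{(j)}\rangle=0$ for all $i,j$; and (2) there is $\varepsilon>0$ such that for all $t\in[0,\varepsilon)$ and all nonempty $I\subseteq\{1,2\}$, $T^s([A^{(i)}+t\dot A^{(i)}]_I)\ge0$ for all $i$ and $T^s([B^{(j)}+t\dot B^{(j)}]_I)\ge0$ for all $j$. Here $[X]_I$ is the principal minor of $X$ with index set $I$, and $T^s(f)$ is the Taylor polynomial of order $s$ at $t=0$ of the polynomial $f(t)$. Put $\operatorname{vec}(X)=(X_{11},X_{22},\sqrt2X_{12})$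 (row vector). If $M\in\mathcal{M}_{3,2}^{p\times q}$, every $s$-infinitesimal motion is given by a unique $D\in\mathbb{R}^{3\times3}$ via $\operatorname{vec}(\dot A^{(i)})=\operatorname{vec}(A^{(i)})D$ and $\operatorname{vec}(\dot B^{(j)})^T=-D\operatorname{vec}(B^{(j)})^T$. The motion is $s$-trivial if the same $D$ gives, by these formulas, an $s$-infinitesimal motion of every size-$2$ psd factorization of every matrix in $\mathcal{M}_{3,2}^{p\times q}$. A size-$2$ psd factorization of $M$ is $s$-infinitesimally rigid if all its $s$-infinitesimal motions are $s$-trivial. *)

(* Defs.v *)
From mathcomp Require Import all_boot all_order all_algebra.
From mathcomp Require Import reals.
Set Implicit Arguments.
Unset Strict Implicit.
Unset Printing Implicit Defensive.
Import Order.TTheory GRing.Theory Num.Theory.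
Local Open Scope ring_scope.

Definition psd (R : realType) (k : nat) (X : 'M[R]_k) : Prop :=
  X^T = X /\ forall x : 'cV[R]_k, 0 <= (x^T *m X *m x) 0 0.

Definition inner (R : realType) (k : nat) (X Y : 'M[R]_k) : R := \tr (X *m Y).

Definition dot (R : realType) (a b : 'cV[R]_2) : R := (a^T *m b) 0 0.

Definition det2 (R : realType) (a b : 'cV[R]_2) : R :=
  \det (row_mx a b : 'M[R]_2).

Definition psd_factorization (R : realType) (p q k : nat) (M : 'M[R]_(p, q))
    (A : 'I_p -> 'M[R]_k) (B : 'I_q -> 'M[R]_k) : Prop :=
  [/\ forall i, psd (A i), forall j, psd (B j) &
      forall i j, M i j = inner (A i) (B j)].

Definition has_psd_factorization (R : realType) (p q : nat) (M : 'M[R]_(p, q))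
    (k : nat) : Prop :=
  exists (A : 'I_p -> 'M[R]_k) (B : 'I_q -> 'M[R]_k), psd_factorization M A B.

(* A relation rather than a function: a matrix with a negative entry has no
   psd factorization, hence no psd rank. *)
Definition psd_rank_is (R : realType) (p q : nat) (M : 'M[R]_(p, q))
    (k : nat) : Prop :=
  has_psd_factorization M k /\
  forall l : nat, has_psd_factorization M l -> (k <= l)%N.

Definition in_M32 (R : realType) (p q : nat) (M : 'M[R]_(p, q)) : Prop :=
  [/\ forall i j, 0 <= M i j, \rank M = 3%N & psd_rank_is M 2].

Definition principal_minor (S : comNzRingType) (n : nat) (X : 'M[S]_n)
    (I : {set 'I_n}) : S :=
  \det (mxsub (fun u : 'I_#|I| => enum_val u) (fun v : 'I_#|I| => enum_val v) X).

Definition taylor0 (R : realType) (s : nat) (f : {poly R}) : {poly R} :=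
  \poly_(i < s.+1) (f^`(i).[0] / (i`!)%:R).

(* X + t dX, as a matrix of polynomials in the indeterminate t. *)
Definition perturb (R : realType) (n : nat) (X dX : 'M[R]_n) : 'M[{poly R}]_n :=
  map_mx polyC X + 'X *: map_mx polyC dX.

Definition inf_motion (R : realType) (s p q : nat)
    (A : 'I_p -> 'M[R]_2) (B : 'I_q -> 'M[R]_2)
    (dA : 'I_p -> 'M[R]_2) (dB : 'I_q -> 'M[R]_2) : Prop :=
  [/\ forall i, (dA i)^T = dA i,
      forall j, (dB j)^T = dB j,
      forall i j, inner (dA i) (B j) + inner (A i) (dB j) = 0 &
      exists2 e : R, 0 < e &
        forall t : R, 0 <= t < e ->
        forall I : {set 'I_2}, I != set0 ->
          (forall i,
             0 <= (taylor0 s (principal_minor (perturb (A i) (dA i)) I)).[t]) /\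
          (forall j,
             0 <= (taylor0 s (principal_minor (perturb (B j) (dB j)) I)).[t])].

(* With 0-based indices: (X_11, X_22, sqrt 2 * X_12). *)
Definition vec (R : realType) (X : 'M[R]_2) : 'rV[R]_3 :=
  \row_(k < 3) [:: X 0 0; X 1 1; Num.sqrt 2%:R * X 0 1]`_k.

Definition given_by (R : realType) (p q : nat) (D : 'M[R]_3)
    (A : 'I_p -> 'M[R]_2) (B : 'I_q -> 'M[R]_2)
    (dA : 'I_p -> 'M[R]_2) (dB : 'I_q -> 'M[R]_2) : Prop :=
  (forall i, vec (dA i) = vec (A i) *m D) /\
  (forall j, (vec (dB j))^T = - (D *m (vec (B j))^T)).

(* In the inner existential, dA' and dB' are determined by D, A', B', since vec
   is a bijection from the symmetric 2 x 2 matrices onto R^3 and motions are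
   symmetric.  In trivial_motion, D is determined by the motion whenever (A, B)
   factorizes a matrix of rank 3. *)
Definition universal (R : realType) (s p q : nat) (D : 'M[R]_3) : Prop :=
  forall (M' : 'M[R]_(p, q)) (A' : 'I_p -> 'M[R]_2) (B' : 'I_q -> 'M[R]_2),
    in_M32 M' -> psd_factorization M' A' B' ->
    exists (dA' : 'I_p -> 'M[R]_2) (dB' : 'I_q -> 'M[R]_2),
      given_by D A' B' dA' dB' /\ inf_motion s A' B' dA' dB'.

Definition trivial_motion (R : realType) (s p q : nat)
    (A : 'I_p -> 'M[R]_2) (B : 'I_q -> 'M[R]_2)
    (dA : 'I_p -> 'M[R]_2) (dB : 'I_q -> 'M[R]_2) : Prop :=
  exists D : 'M[R]_3, given_by D A B dA dB /\ universal s p q D.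

Definition inf_rigid (R : realType) (s p q : nat)
    (A : 'I_p -> 'M[R]_2) (B : 'I_q -> 'M[R]_2) : Prop :=
  forall (dA : 'I_p -> 'M[R]_2) (dB : 'I_q -> 'M[R]_2),
    inf_motion s A B dA dB -> trivial_motion s A B dA dB.

(* Main.v *)
Require Import Defs.
From mathcomp Require Import all_boot all_order all_algebra.
From mathcomp Require Import fingroup perm.
From mathcomp Require Import reals.
From mathcomp Require Import ring lra.
Import Order.TTheory GRing.Theory Num.Theory.
Local Open Scope ring_scope.
Set Implicit Arguments.
Unset Strict Implicit.
Unset Printing Implicit Defensive.

(** A motion is given by a matrix [D] acting on [vec]. For a factor [X = v v^T],
    the derivative of [det X] along the motion is the value at [v] of a binary
    quartic form, [motion_quartic D]; for a factor [b b^T] on the other side it is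
    minus the value of the same form at [perp b] ([motion_quartic_dual]). A small
    motion keeps a positive definite factor positive definite, so the first order
    conditions on [D] say exactly that its quartic is [>= 0] at the vectors [a_i]
    and [<= 0] at the vectors [perp b_j] of the rank one factors
    ([inf_motion_gen]). Every binary quartic arises from some [D]
    ([motion_quartic_surj]).

    A universal [D] satisfies both conditions at every vector, since every vector
    occurs in some factorization on either side; so its quartic is zero
    ([universal_motion_quartic0]). Conversely, if the quartic is zero, then [D]
    generates the action of a matrix [S], by [dX = S X + X S^T], and then
    [det dX] is minus the square of a quadratic form in [v] ([det_rank1]). For
    [s = 1], being universal means that the quartic is zero; for [s = 2], a zero
    quartic and a zero quadratic form are enough
    ([universal_of_motion_quartic0]).

    So the question is whether a nonzero binary quartic can be [>= 0] at the
    points [a_i] and [<= 0] at the points [perp b_j] of the projective line, all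
    of them distinct. The values of a quartic at six points [x_k] satisfy one
    linear relation, in which the value at [x_k] has the coefficient
    [1 / \prod_(l != k) det2 x_k x_l]. The five quotients of the theorem compare
    these coefficients for three [a]'s and three [perp b]'s: they are positive
    when the two triples alternate around the projective line.

    If there is such a pair of triples, the relation is a sum of terms of one
    sign, so the quartic vanishes at the six points and is zero
    ([interlaced_quartic_eq0]). For [s = 2] the quadratic form then vanishes at
    three points [a_i], and is zero as well.

    If there is none, then on an affine chart the points, sorted by slope, have
    at most four changes of type, and the polynomial with one root at each change
    has degree at most four and the required strict signs
    ([alternation_dichotomy]). The motion of that quartic satisfies the
    conditions strictly at first order, hence also at second order
    ([strict_inf_motion]), and it is not trivial. *)

(** * Plane vectors and binary forms *)

Lemma det_mx2 (S : comNzRingType) (X : 'M[S]_2) :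
  \det X = X 0 0 * X 1 1 - X 0 1 * X 1 0.
Proof.
have e0 : @lift 2 0 0 = 1 by apply/val_inj.
have e1 : @lift 2 1 0 = 0 by apply/val_inj.
rewrite (expand_det_row _ 0) !big_ord_recl big_ord0 /cofactor !det_mx11.
by rewrite !mxE /= !(e0, e1) expr0 expr1; ring.
Qed.

Lemma ord2P (i : 'I_2) : (i == 0) || (i == 1).
Proof. by case: i => [[|[]]]. Qed.

Section BinaryForms.
Variable R : realType.
Implicit Types (p : {poly R}) (u v w : 'cV[R]_2).

Lemma det2E u v : det2 u v = u 0 0 * v 1 0 - v 0 0 * u 1 0.
Proof.
have s0 : split (0 : 'I_(1 + 1)) = inl 0.
  by case: splitP => // j _; rewrite (ord1 j).
have s1 : split (1 : 'I_(1 + 1)) = inr 0.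
  by case: splitP => [[[]]|j _] //; rewrite (ord1 j).
by rewrite /det2 det_mx2 !mxE !s0 !s1.
Qed.

Lemma cV2P u v : u 0 0 = v 0 0 -> u 1 0 = v 1 0 -> u = v.
Proof.
by move=> e0 e1; apply/matrixP => i j; rewrite (ord1 j); case/orP: (ord2P i) => /eqP ->.
Qed.

Lemma dotE u v : dot u v = u 0 0 * v 0 0 + u 1 0 * v 1 0.
Proof.
rewrite /dot mxE !big_ord_recl big_ord0 !mxE addr0.
by rewrite (_ : lift 0 0 = 1) //; apply/val_inj.
Qed.

(** The quarter turn: it makes scalar products into determinants, so that the
    vectors [a_i] and [perp b_j] lie on one projective line. *)
Definition perp v : 'cV[R]_2 := \col_(i < 2) [:: - v 1 0; v 0 0]`_i.

Lemma perpE v : (perp v 0 0 = - v 1 0) * (perp v 1 0 = v 0 0).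
Proof. by rewrite !mxE. Qed.

Lemma perp_eq0 v : (perp v == 0) = (v == 0).
Proof.
apply/eqP/eqP => [pv0|->]; last by apply: cV2P; rewrite perpE !mxE ?oppr0.
have e k : perp v k 0 = 0 by rewrite pv0 mxE.
by apply: cV2P; rewrite mxE -?(perpE v).2 ?e // -[LHS]opprK -(perpE v).1 e oppr0.
Qed.

Lemma det2_perp u v : det2 (perp u) (perp v) = det2 u v.
Proof. by rewrite !det2E !perpE; ring. Qed.

Lemma det2_perpr u v : det2 u (perp v) = dot u v.
Proof. by rewrite det2E dotE !perpE; ring. Qed.

(** The homogenization of [p] in degree [n]. The degree is a parameter because a
    form that vanishes at the point at infinity has [size p <= n]. *)
Definition bform n p v := \sum_(i < n.+1) p`_i * v 0 0 ^+ i * v 1 0 ^+ (n - i).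

Lemma bform0 n v : bform n 0 v = 0.
Proof. by rewrite /bform big1 // => i _; rewrite coef0 !mul0r. Qed.

Lemma bformB n p q v : bform n (p - q) v = bform n p v - bform n q v.
Proof.
rewrite /bform -sumrB; apply: eq_bigr => i _.
by rewrite coefB !mulrBl.
Qed.

Lemma bformZ n c p v : bform n (c *: p) v = c * bform n p v.
Proof.
rewrite /bform mulr_sumr; apply: eq_bigr => i _.
by rewrite coefZ !mulrA.
Qed.

Lemma bform_sum n (I : Type) (s : seq I) (F : I -> {poly R}) v :
  bform n (\sum_(i <- s) F i) v = \sum_(i <- s) bform n (F i) v.
Proof.
rewrite /bform exchange_big; apply: eq_bigr => i _.
by rewrite coef_sum !mulr_suml.
Qed.

Lemma bform_affine n p v : (size p <= n.+1)%N -> v 1 0 != 0 ->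
  bform n p v = v 1 0 ^+ n * p.[v 0 0 / v 1 0].
Proof.
move=> sp v1; rewrite (horner_coef_wide _ sp) mulr_sumr.
apply: eq_bigr => i _.
have le_in : (i <= n)%N by rewrite -ltnS.
have -> : v 1 0 ^+ n = v 1 0 ^+ (n - i) * v 1 0 ^+ i by rewrite -exprD subnK.
by rewrite expr_div_n; field; rewrite expf_neq0.
Qed.

Lemma bform_infinity n p v : v 1 0 = 0 -> bform n p v = p`_n * v 0 0 ^+ n.
Proof.
move=> v1; rewrite /bform big_ord_recr /= subnn expr0 mulr1 big1 ?add0r // => i _.
by rewrite v1 expr0n subn_eq0 leqNgt ltn_ord mulr0.
Qed.

Definition gen_pos (s : seq 'cV[R]_2) :=
  [/\ uniq s, 0 \notin s & {in s &, forall u v, u != v -> det2 u v != 0}].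

(** The points with [v 1 0 != 0] give distinct roots [v 0 0 / v 1 0] of [p]. At
    most one point is at infinity; vanishing there kills the top coefficient,
    which lowers the bound on the number of roots by one. *)
Lemma bform_eq0 n p s : (size p <= n.+1)%N -> (n < size s)%N -> gen_pos s ->
  (forall v, v \in s -> bform n p v = 0) -> p = 0.
Proof.
move=> sp ss [us s0 sdet] sp0; apply/eqP/negPn/negP => p0.
pose aff := [pred v : 'cV[R]_2 | v 1 0 != 0].
pose z v : R := v 0 0 / v 1 0.
have ltf : (size (filter aff s) < size p)%N.
  rewrite -(size_map z); apply: max_poly_roots => //.
    apply/allP => _ /mapP[v vs ->]; move: vs; rewrite mem_filter /= => /andP[v1 vs].
    apply/rootP; have := sp0 v vs; rewrite bform_affine //.
    by move/eqP; rewrite mulf_eq0 expf_eq0 (negbTE v1) andbF => /eqP.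
  rewrite map_inj_in_uniq ?filter_uniq // => u v.
  rewrite !mem_filter /= => /andP[u1 us'] /andP[v1 vs] /eqP; rewrite /z eqr_div // => /eqP e.
  apply/eqP/negPn/negP => /(sdet _ _ us' vs).
  by rewrite det2E e subrr eqxx.
have := count_predC aff s; rewrite -!size_filter.
case E : (filter (predC aff) s) (filter_uniq (predC aff) us) => [|v [|w r]] /=.
- move=> _ eqs; move: ss; rewrite -eqs addn0 => ss.
  by have := leq_trans ltf (leq_trans sp ss); rewrite ltnn.
- move=> _ eqs.
  have vs : v \in filter (predC aff) s by rewrite E mem_head.
  move: vs; rewrite mem_filter /= negbK => /andP[/eqP v1 vs].
  have v0 : v 0 0 != 0.
    by apply: contraNneq s0 => v0; rewrite -(_ : v = 0) //; apply: cV2P; rewrite mxE.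
  have pn : p`_n = 0.
    apply/eqP; have /eqP := sp0 v vs; rewrite bform_infinity //.
    by rewrite mulf_eq0 expf_eq0 (negbTE v0) andbF orbF.
  have spn : (size p <= n)%N.
    apply/leq_sizeP => j; rewrite leq_eqVlt => /orP[/eqP <- //|nj].
    by move/leq_sizeP: sp; apply.
  have := leq_trans ltf spn; move: ss; rewrite -eqs addn1 ltnS => h1 h2.
  by have := leq_trans h2 h1; rewrite ltnn.
rewrite inE negb_or -andbA => /and3P[vw _ _].
have vs : v \in filter (predC aff) s by rewrite E mem_head.
have ws : w \in filter (predC aff) s by rewrite E !inE eqxx orbT.
move: vs ws; rewrite !mem_filter /= !negbK => /andP[/eqP v1 vs] /andP[/eqP w1 ws].
by have := sdet v w vs ws vw; rewrite det2E v1 w1 !mulr0 subrr eqxx.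
Qed.

(** The coefficients of the linear form [w |-> det2 w v]. *)
Definition bline v : {poly R} := v 1 0 *: 'X - (v 0 0)%:P.

Lemma bform_mul_line n p v w : (size p <= n.+1)%N ->
  bform n.+1 (p * bline v) w = bform n p w * det2 w v.
Proof.
move=> sp; rewrite /bline mulrBr -scalerAr mulrC [p * _%:P]mulrC mul_polyC bformB !bformZ.
have -> : bform n.+1 ('X * p) w = w 0 0 * bform n p w.
  rewrite /bform big_ord_recl coefXM mul0r mul0r add0r mulr_sumr.
  by apply: eq_bigr => i _; rewrite coefXM /= subSS exprS; ring.
have -> : bform n.+1 p w = w 1 0 * bform n p w.
  rewrite /bform big_ord_recr /= (leq_sizeP _ _ sp) // !mul0r addr0 mulr_sumr.
  apply: eq_bigr => i _; rewrite subSn; last by rewrite -ltnS.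
  by rewrite exprS; ring.
by rewrite det2E; ring.
Qed.

Definition blines (s : seq 'cV[R]_2) := \prod_(v <- s) bline v.

Lemma size_blines s : (size (blines s) <= (size s).+1)%N.
Proof.
rewrite /blines; elim: s => [|v s IH]; first by rewrite big_nil size_poly1.
rewrite big_cons; apply: leq_trans (size_polyMleq _ _) _.
have sl : (size (bline v) <= 2)%N.
  rewrite (leq_trans (size_polyD _ _)) // geq_max size_polyN.
  rewrite (leq_trans (size_scale_leq _ _)) ?size_polyX //.
  by rewrite (leq_trans (size_polyC_leq1 _)).
by rewrite -subn1 leq_subLR; exact: leq_add sl IH.
Qed.

Lemma bform_blines s w : bform (size s) (blines s) w = \prod_(v <- s) det2 w v.
Proof.
elim: s => [|v s IH].
  by rewrite /bform /blines !big_nil big_ord1 coef1 !mul1r.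
rewrite /blines !big_cons mulrC [size _]/= bform_mul_line ?size_blines //.
by rewrite IH mulrC.
Qed.

(** Lagrange interpolation: the difference of the two sides is a form of degree
    [n] in [w] that vanishes at the [n + 1] points of [s]. *)
Lemma interpolation n p s w : (size p <= n.+1)%N -> size s = n.+1 -> gen_pos s ->
  bform n p w =
  \sum_(v <- s) bform n p v * \prod_(u <- rem v s) (det2 w u / det2 v u).
Proof.
move=> sp ss gs; have [us _ sdet] := gs.
pose c v := bform n p v / \prod_(u <- rem v s) det2 v u.
pose q := p - \sum_(v <- s) c v *: blines (rem v s).
have bq v : bform n q v = bform n p v -
    \sum_(u <- s) c u * \prod_(x <- rem u s) det2 v x.
  rewrite bformB bform_sum; congr (_ - _); apply: eq_big_seq => u us'.
  have szr : size (rem u s) = n by rewrite size_rem // ss.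
  by rewrite bformZ -[X in bform X]szr bform_blines.
have q0 : q = 0.
  apply: (@bform_eq0 n _ s) => //; first last.
  - move=> v vs; rewrite bq (bigD1_seq v) //= [X in _ - (_ + X)]big1_seq ?addr0.
      rewrite /c divfK ?subrr //; rewrite prodf_seq_neq0; apply/allP => u.
      rewrite mem_rem_uniq // inE => /andP[uv us'].
      by apply/implyP => _; apply: sdet; rewrite // eq_sym.
    move=> u /andP[uv us']; have vr : v \in rem u s.
      by rewrite mem_rem_uniq // inE eq_sym uv.
    by rewrite (big_rem v vr) /= det2E subrr mul0r mulr0.
  - by rewrite ss.
  rewrite (leq_trans (size_polyD _ _)) // geq_max sp size_polyN big_seq.
  apply: (big_ind (fun r : {poly R} => (size r <= n.+1)%N)).
  - by rewrite size_poly0.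
  - by move=> x y hx hy; rewrite (leq_trans (size_polyD _ _)) // geq_max hx.
  move=> u us'; rewrite (leq_trans (size_scale_leq _ _)) //.
  by rewrite (leq_trans (size_blines _)) // size_rem // ss.
apply/eqP; rewrite -subr_eq0.
rewrite [X in _ - X](_ : _ = \sum_(u <- s) c u * \prod_(x <- rem u s) det2 w x).
  by rewrite -bq q0 bform0.
apply: eq_bigr => v _.
by rewrite /c -mulrA; congr (_ * _); rewrite big_split /= prodfV mulrC.
Qed.

(** In the linear relation between the values of a quartic form at the six
    points [a1], [a2], [a3], [perp b1], [perp b2], [perp b3], these are the
    coefficients at the first five points divided by the one at [perp b3], with
    the sign reversed for the [a]'s. So the relation has one sign on the [a]'s
    and the other on the [perp b]'s, which means that the two triples alternate
    around the projective line. *)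
Definition interlaced (a1 a2 a3 b1 b2 b3 : 'cV[R]_2) :=
  [/\ 0 < (det2 b1 b3 * det2 b2 b3 * dot a2 b3 * dot a3 b3)
          / (det2 a1 a2 * det2 a1 a3 * dot a1 b1 * dot a1 b2),
      0 < - ((det2 b1 b3 * det2 b2 b3 * dot a1 b3 * dot a3 b3)
             / (det2 a1 a2 * det2 a2 a3 * dot a2 b1 * dot a2 b2)),
      0 < (det2 b1 b3 * det2 b2 b3 * dot a1 b3 * dot a2 b3)
          / (det2 a1 a3 * det2 a2 a3 * dot a3 b1 * dot a3 b2),
      0 < (det2 b2 b3 * dot a1 b3 * dot a2 b3 * dot a3 b3)
          / (det2 b1 b2 * dot a1 b1 * dot a2 b1 * dot a3 b1)
    & 0 < - ((det2 b1 b3 * dot a1 b3 * dot a2 b3 * dot a3 b3)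
             / (det2 b1 b2 * dot a1 b2 * dot a2 b2 * dot a3 b2))].

Lemma det2C u v : det2 u v = - det2 v u.
Proof. by rewrite !det2E; ring. Qed.

Lemma det2_neq0 u v : det2 u v != 0 -> [/\ u != 0, v != 0 & u != v].
Proof.
by move=> d; split; apply: contraNneq d => ->; rewrite det2E ?mxE; apply/eqP; ring.
Qed.

Lemma gen_pos_pairwise s : (1 < size s)%N ->
  pairwise (fun u v => det2 u v != 0) s -> gen_pos s.
Proof.
move=> s1 ds.
have us : uniq s.
  rewrite uniq_pairwise; apply: sub_pairwise ds => u v.
  by case/det2_neq0.
have dN : {in s &, forall u v, u != v -> det2 u v != 0}.
  move=> _ _ /(nthP 0)[i ltis <-] /(nthP 0)[j ltjs <-].
  rewrite nth_uniq // neq_ltn => /orP[] lt.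
    by apply: (pairwiseP 0 ds) lt; rewrite inE.
  by rewrite det2C oppr_eq0; apply: (pairwiseP 0 ds) lt; rewrite inE.
split=> //; apply/negP => s0.
have /hasP[v vs v0] : has (predC1 0) s.
  rewrite has_predC; apply: contraL s1 => /all_pred1P es.
  by move: us; rewrite es; case: (size s) => [|[|n]] //=; rewrite inE eqxx.
by have [_ /eqP] := det2_neq0 (dN _ _ vs s0 v0).
Qed.

(** Interpolation from the first five points expresses the value at [perp b3],
    which is [<= 0], with the five quotients as weights, up to the sign at
    [perp b1] and [perp b2]; so it is also a sum of terms [>= 0]. Hence all
    terms vanish, and a quartic with five zeros is zero. *)
Lemma interlaced_quartic_eq0 p a1 a2 a3 b1 b2 b3 :
  (size p <= 5)%N ->
  pairwise (fun u v => det2 u v != 0) [:: a1; a2; a3; perp b1; perp b2] ->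
  0 <= bform 4 p a1 -> 0 <= bform 4 p a2 -> 0 <= bform 4 p a3 ->
  bform 4 p (perp b1) <= 0 -> bform 4 p (perp b2) <= 0 -> bform 4 p (perp b3) <= 0 ->
  interlaced a1 a2 a3 b1 b2 b3 ->
  p = 0.
Proof.
move=> sp pw; have gp := gen_pos_pairwise (isT : (1 < size [:: _, _ & _])%N) pw.
have [us _ _] := gp.
have := interpolation (perp b3) sp (erefl : size [:: _;_;_;_;_] = 5) gp.
move: us; rewrite /= !inE !negb_or => /and5P[/and4P[n12 n13 n14 n15]
  /and3P[n23 n24 n25] /andP[n34 n35] n45 _].
have nE := (negbTE n12, negbTE n13, negbTE n14, negbTE n15, negbTE n23,
  negbTE n24, negbTE n25, negbTE n34, negbTE n35, negbTE n45).
rewrite !big_cons !big_nil /= !eqxx !nE.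
rewrite !big_cons !big_nil !det2_perp.
rewrite !(det2C (perp _) a1) !(det2C (perp _) a2) !(det2C (perp _) a3) !det2_perpr.
move: pw; rewrite /= !det2_perp !det2_perpr !andbT.
move=> /and4P[/and4P[d12 d13 f11 f12] /and3P[d23 f21 f22] /andP[f31 f32] e12].
rewrite [det2 a2 a1]det2C [det2 a3 a1]det2C [det2 a3 a2]det2C.
rewrite [det2 b3 b1]det2C [det2 b3 b2]det2C [det2 b2 b1]det2C.
move=> eqw q1 q2 q3 q4 q5 q6 [r1 r2 r3 r4 r5].
(* The interpolation formula, arranged so that every summand is nonnegative. *)
have {}eqw : - bform 4 p (perp b3) +
    (det2 b1 b3 * det2 b2 b3 * dot a2 b3 * dot a3 b3 /
     (det2 a1 a2 * det2 a1 a3 * dot a1 b1 * dot a1 b2)) * bform 4 p a1 +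
    (- (det2 b1 b3 * det2 b2 b3 * dot a1 b3 * dot a3 b3 /
     (det2 a1 a2 * det2 a2 a3 * dot a2 b1 * dot a2 b2))) * bform 4 p a2 +
    (det2 b1 b3 * det2 b2 b3 * dot a1 b3 * dot a2 b3 /
     (det2 a1 a3 * det2 a2 a3 * dot a3 b1 * dot a3 b2)) * bform 4 p a3 +
    (det2 b2 b3 * dot a1 b3 * dot a2 b3 * dot a3 b3 /
     (det2 b1 b2 * dot a1 b1 * dot a2 b1 * dot a3 b1)) * (- bform 4 p (perp b1)) +
    (- (det2 b1 b3 * dot a1 b3 * dot a2 b3 * dot a3 b3 /
     (det2 b1 b2 * dot a1 b2 * dot a2 b2 * dot a3 b2))) * (- bform 4 p (perp b2)) = 0.
  rewrite eqw; move: d12 d13 f11 f12 d23 f21 f22 f31 f32 e12; clear.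
  move: (bform 4 p a1) (bform 4 p a2) (bform 4 p a3) (bform 4 p (perp b1)) (bform 4 p (perp b2)).
  move: (det2 a1 a2) (det2 a1 a3) (det2 a2 a3) (det2 b1 b2) (det2 b1 b3) (det2 b2 b3).
  move: (dot a1 b1) (dot a1 b2) (dot a1 b3) (dot a2 b1) (dot a2 b2) (dot a2 b3)
    (dot a3 b1) (dot a3 b2) (dot a3 b3).
  move=> x1 x2 x3 x4 x5 x6 x7 x8 x9 y1 y2 y3 y4 y5 y6 z1 z2 z3 z4 z5 *.
  by field; do ![apply/andP; split => //].
have zero_add (x y : R) : 0 <= x -> 0 <= y -> x + y = 0 -> x = 0 /\ y = 0.
  by move=> x0 y0 xy; split; lra.
have zero_mul (x y : R) : 0 < x -> x * y = 0 -> y = 0.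
  by move=> x0 /eqP; rewrite mulf_eq0 gt_eqF //= => /eqP.
have nn (x y : R) : 0 < x -> 0 <= y -> 0 <= x * y by move=> x0 y0; rewrite mulr_ge0 // ltW.
rewrite -!oppr_ge0 in q4 q5 q6.
have n1 := nn _ _ r1 q1; have n2 := nn _ _ r2 q2; have n3 := nn _ _ r3 q3.
have n4 := nn _ _ r4 q4; have n5 := nn _ _ r5 q5.
have s1 := addr_ge0 q6 n1; have s2 := addr_ge0 s1 n2.
have s3 := addr_ge0 s2 n3; have s4 := addr_ge0 s3 n4.
have {eqw}[eqw /(zero_mul _ _ r5) z5] := zero_add _ _ s4 n5 eqw.
have {eqw}[eqw /(zero_mul _ _ r4) z4] := zero_add _ _ s3 n4 eqw.
have {eqw}[eqw /(zero_mul _ _ r3) z3] := zero_add _ _ s2 n3 eqw.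
have {eqw}[eqw /(zero_mul _ _ r2) z2] := zero_add _ _ s1 n2 eqw.
have {eqw}[_ /(zero_mul _ _ r1) z1] := zero_add _ _ q6 n1 eqw.
rewrite -oppr0 in z4 z5; have {}z4 := oppr_inj z4; have {}z5 := oppr_inj z5.
apply: (bform_eq0 sp _ gp) => // v; rewrite !inE.
by do 4![case/predU1P => [->|] //]; move/eqP ->.
Qed.

End BinaryForms.

(** * Polynomials with prescribed signs on a line *)

Section SignAlternation.
Variables (R : realType) (T : eqType) (t : T -> R) (sg : T -> bool).

Definition alternates (x y : T) := (t x < t y) && (sg x != sg y).

(** One root between any two consecutive points of different signs. The sign
    condition on the whole half-line left of [t x] is what the induction needs:
    a new first point either has the sign of that half-line already, or gets it
    from a factor ['X - r%:P] whose root [r] separates it from the other points.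
    The alternating chain [u] starts at [x] and grows together with the degree. *)
Lemma sign_pattern x s : path (relpre t <%R) x s ->
  exists (p : {poly R}) (u : seq T),
    [/\ path alternates x u, {subset u <= s}, (size p <= (size u).+1)%N,
        forall z, z <= t x -> 0 < (-1) ^+ sg x * p.[z] &
        forall y, y \in s -> 0 < (-1) ^+ sg y * p.[t y]].
Proof.
elim: s x => [|y s IH] x /=.
  move=> _; exists ((-1) ^+ sg x)%:P, [::]; split=> //.
    by rewrite size_polyC_leq1.
  by move=> z _; rewrite hornerC -expr2 sqrr_sign.
case/andP=> xy ys; have [p [u [alt us sp left right]]] := IH y ys.
have lefty : 0 < (-1) ^+ sg y * p.[t y] by apply: left.
have [sxy|sxy] := eqVneq (sg x) (sg y).
  exists p, u; split=> //.
  - case: u alt us {sp} => //= z u /andP[/andP[yz syz] alt] us.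
    by rewrite alt /alternates sxy syz (lt_trans xy yz).
  - by move=> z zu; rewrite inE us ?orbT.
  - by move=> z zx; rewrite sxy left // (le_trans zx) // ltW.
  by move=> z /predU1P[->|/right].
pose r := (t x + t y) / 2%:R.
have [xr ry] : t x < r /\ r < t y by rewrite /r; move: (xy : t x < t y); clear; lra.
exists (('X - r%:P) * p), (y :: u); split.
- by rewrite /= alt andbT /alternates sxy andbT.
- by move=> z; rewrite !inE => /predU1P[->|/us ->]; rewrite ?eqxx ?orbT.
- rewrite (leq_trans (size_polyMleq _ _)) // size_XsubC /=.
  by rewrite ltnS (leq_trans sp).
- move=> z zx; rewrite hornerM hornerXsubC.
  have -> : (-1) ^+ sg x = - (-1) ^+ sg y :> R.
    by move: sxy; case: (sg x); case: (sg y); rewrite //= ?opprK.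
  rewrite mulNr mulrCA -mulNr opprB mulr_gt0 ?left //.
    by rewrite subr_gt0 (le_lt_trans zx).
  by rewrite (le_trans zx) // ltW.
have tail z : r < t z -> 0 < (-1) ^+ sg z * p.[t z] ->
    0 < (-1) ^+ sg z * (('X - r%:P) * p).[t z].
  by move=> rz pz; rewrite hornerM hornerXsubC mulrCA mulr_gt0 // subr_gt0.
move=> z /predU1P[->|zs]; first exact: tail.
apply: tail; last exact: right.
have tr : transitive (relpre t <%R) by move=> a b c; apply: lt_trans.
by rewrite (lt_trans ry) //; apply: (allP (order_path_min tr ys)).
Qed.

(** A chain of [n + 2] alternating points is the only obstruction to prescribing
    signs by a polynomial of degree at most [n]. *)
Lemma alternation_dichotomy n s : uniq s -> {in s &, injective t} ->
  (exists x u, [/\ size u = n.+1, path alternates x u & {subset x :: u <= s}]) \/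
  (exists p : {poly R}, [/\ (size p <= n.+1)%N, p != 0 &
     forall y, y \in s -> 0 < (-1) ^+ sg y * p.[t y]]).
Proof.
move=> us tinj; set s' := sort (relpre t <=%R) s.
have ms : s' =i s by apply: mem_sort.
have sorted_s' : sorted (relpre t <%R) s'.
  rewrite -sorted_map lt_sorted_uniq_le sorted_map sort_sorted ?andbT.
    by rewrite map_inj_in_uniq ?sort_uniq // => x y; rewrite !ms; apply: tinj.
  by move=> x y; apply: le_total.
case E : s' sorted_s' ms => [|x r] /= sr ms.
  by right; exists 1; rewrite size_poly1 oner_eq0; split=> // y; rewrite -ms.
have [p [u [alt ur sp left right]]] := sign_pattern sr.
have [su|su] := leqP (size u) n.
  right; exists p; split; first exact: leq_trans sp _.
    apply/eqP => p0; have := left (t x) (lexx _).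
    by rewrite p0 horner0 mulr0 ltxx.
  by move=> y; rewrite -ms inE => /predU1P[->|/right //]; apply: left.
left; exists x, (take n.+1 u); split; first by rewrite size_takel.
  exact: take_path.
move=> z; rewrite inE -ms => /predU1P[->|/mem_take/ur zr]; first exact: mem_head.
by rewrite inE zr orbT.
Qed.

End SignAlternation.

(** * An affine chart containing all the points *)

Section Shear.
Variable R : realType.
Implicit Types (p : {poly R}) (u v w : 'cV[R]_2) (c : R).

Definition shear c v : 'cV[R]_2 := \col_(i < 2) [:: v 0 0; v 1 0 - c * v 0 0]`_i.

Lemma shearE c v : (shear c v 0 0 = v 0 0) * (shear c v 1 0 = v 1 0 - c * v 0 0).
Proof. by rewrite !mxE. Qed.

(** Any [c] larger than all the quotients [v 1 0 / v 0 0] works. *)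
Lemma exists_shear (s : seq 'cV[R]_2) : 0 \notin s ->
  exists c, {in s, forall v, shear c v 1 0 != 0}.
Proof.
move=> s0.
have [c cP] : exists c : R, {in s, forall v, v 1 0 / v 0 0 < c}.
  elim: s {s0} => [|v s [c cP]]; first by exists 0.
  exists (Num.max c (v 1 0 / v 0 0 + 1)) => w /predU1P[->|/cP ws].
    by rewrite lt_max ltrDl ltr01 orbT.
  by rewrite lt_max ws.
exists c => v vs; have := cP v vs; rewrite shearE; have [v0 _|v0] := eqVneq (v 0 0) 0.
  rewrite v0 mulr0 subr0; apply: contraNneq s0 => v1.
  by rewrite -(_ : v = 0) //; apply: cV2P; rewrite mxE.
apply: contraTneq => /eqP; rewrite subr_eq0 => /eqP ->.
by rewrite mulfK // ltxx.
Qed.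

Definition slope v := v 0 0 / v 1 0.

Lemma det2_slope c u v : shear c u 1 0 != 0 -> shear c v 1 0 != 0 ->
  det2 u v = shear c u 1 0 * shear c v 1 0 * (slope (shear c u) - slope (shear c v)).
Proof.
move=> u1 v1; rewrite /slope det2E.
transitivity (det2 (shear c u) (shear c v)); first by rewrite det2E !shearE; ring.
by rewrite det2E; field; rewrite u1 v1.
Qed.

(** The coefficients come from expanding the powers of [v 1 0 - c * v 0 0]. *)
Lemma bform_shear c p : exists2 q : {poly R}, (size q <= 5)%N &
  forall v, bform 4 q v = bform 4 p (shear c v).
Proof.
exists (Poly [:: p`_0; p`_1 - 4%:R * c * p`_0;
                 p`_2 - 3%:R * c * p`_1 + 6%:R * c ^+ 2 * p`_0;
                 p`_3 - 2%:R * c * p`_2 + 3%:R * c ^+ 2 * p`_1 - 4%:R * c ^+ 3 * p`_0;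
                 p`_4 - c * p`_3 + c ^+ 2 * p`_2 - c ^+ 3 * p`_1 + c ^+ 4 * p`_0]).
  exact: size_Poly.
move=> v; rewrite /bform !big_ord_recl !big_ord0 !coef_Poly /= !shearE.
by ring.
Qed.

End Shear.

Section SixSigns.
Variables (R : realType) (c : R) (a1 a2 a3 b1 b2 b3 : 'cV[R]_2).
Let y v := shear c v 1 0.
Let t v := slope (shear c v).

(** By [det2_slope], each determinant is a difference of slopes times two factors
    [y]. In each quotient every [y] occurs an even number of times, so only the
    order of the slopes matters. *)
Lemma slopes_interlaced :
  (forall v, v \in [:: a1; a2; a3; perp b1; perp b2; perp b3] -> y v != 0) ->
  sorted <%R [:: t a1; t (perp b1); t a2; t (perp b2); t a3; t (perp b3)] \/
  sorted <%R [:: t (perp b1); t a1; t (perp b2); t a2; t (perp b3); t a3] ->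
  interlaced a1 a2 a3 b1 b2 b3.
Proof.
move=> yN.
have sgy v : v \in [:: a1; a2; a3; perp b1; perp b2; perp b3] ->
    Num.sg (y v) ^+ 2 = 1 by move=> /yN v0; rewrite sqr_sg v0.
have y1 := sgy a1; have y2 := sgy a2; have y3 := sgy a3.
have y4 := sgy (perp b1); have y5 := sgy (perp b2); have y6 := sgy (perp b3).
rewrite !inE !eqxx !orbT in y1 y2 y3 y4 y5 y6.
have {y1}y1 := y1 isT; have {y2}y2 := y2 isT; have {y3}y3 := y3 isT.
have {y4}y4 := y4 isT; have {y5}y5 := y5 isT; have {y6}y6 := y6 isT.
have sgd u v : u \in [:: a1; a2; a3; perp b1; perp b2; perp b3] ->
  v \in [:: a1; a2; a3; perp b1; perp b2; perp b3] ->
  Num.sg (det2 u v) = Num.sg (y u) * Num.sg (y v) * Num.sg (t u - t v).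
  by move=> us vs; rewrite (@det2_slope _ c) ?yN // !sgrM.
move=> H; rewrite /interlaced -(det2_perp b1 b2) -(det2_perp b1 b3) -(det2_perp b2 b3).
rewrite -!det2_perpr.
have sg_lt u v : t u < t v -> (Num.sg (t u - t v) = -1) * (Num.sg (t v - t u) = 1).
  by move=> uv; rewrite ltr0_sg ?gtr0_sg // ?subr_gt0 ?subr_lt0.
rewrite !(sorted_pairwise lt_trans) /= !andbT in H.
(* After replacing everything by signs, the [y]'s are removed by [y ^+ 2 = 1]. *)
by case: H => /and5P[/and5P[/sg_lt l12 /sg_lt l13 /sg_lt l14 /sg_lt l15 /sg_lt l16]
    /and4P[/sg_lt l23 /sg_lt l24 /sg_lt l25 /sg_lt l26]
    /and3P[/sg_lt l34 /sg_lt l35 /sg_lt l36] /andP[/sg_lt l45 /sg_lt l46] /sg_lt l56];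
  split; rewrite -sgr_gt0 !(sgrN, sgrM, sgrV) !sgd ?inE ?eqxx ?orbT //
    !(l12, l13, l14, l15, l16, l23, l24, l25, l26, l34, l35, l36, l45, l46, l56)
    [X in 0 < X](_ : _ = 1) ?ltr01 //; ring: y1 y2 y3 y4 y5 y6.
Qed.

End SixSigns.

(** * Infinitesimal positivity of a psd matrix *)

Section LocalConditions.
Variable R : realType.
Implicit Types (X dX : 'M[R]_2) (e t : R).

Lemma near0_all (T : finType) (P : T -> R -> Prop) :
  (forall k, exists2 e, 0 < e & forall t, 0 <= t < e -> P k t) ->
  exists2 e, 0 < e & forall t, 0 <= t < e -> forall k, P k t.
Proof.
move=> near_k.
suff [e e0 eP] : exists2 e, 0 < e & forall t, 0 <= t < e -> {in enum T, forall k, P k t}.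
  by exists e => // t te k; apply: eP; rewrite ?mem_enum.
elim: (enum T) => [|k s [e e0 eP]]; first by exists 1.
have [f f0 fP] := near_k k; exists (Num.min e f); first by rewrite lt_min e0.
move=> t; rewrite lt_min => /and3P[t0 te tf] x /predU1P[->|xs].
  by apply: fP; rewrite t0.
by apply: eP xs; rewrite t0.
Qed.

Lemma near0_quadratic (c0 c1 c2 : R) :
  0 <= c0 -> (c0 = 0 -> 0 <= c1) -> (c0 = 0 -> c1 = 0 -> 0 <= c2) ->
  exists2 e, 0 < e & forall t, 0 <= t < e -> 0 <= c0 + c1 * t + c2 * t ^+ 2.
Proof.
have linear (x y : R) : 0 < x -> exists2 e, 0 < e & forall t, 0 <= t < e -> 0 <= x + y * t.
  move=> x0; exists (x / (`|y| + 1)); first by rewrite divr_gt0 // ltr_wpDl.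
  move=> t /andP[t0]; rewrite ltr_pdivlMr ?ltr_wpDl // => te.
  have : - (`|y| * t) <= y * t by rewrite -mulNr ler_wpM2r // lerNl -normrN ler_norm.
  by nra.
rewrite le_eqVlt => /predU1P[<-|c00 _ _].
  move=> /(_ erefl); rewrite le_eqVlt => /predU1P[<- /(_ erefl erefl) c20|c10 _].
    by exists 1 => // t _; rewrite mul0r !add0r mulr_ge0 // sqr_ge0.
  have [e e0 eP] := linear c1 c2 c10; exists e => // t te.
  have := eP t te; case/andP: te => t0 _ /(mulr_ge0 t0); congr (0 <= _).
  by ring.
have [e e0 eP] := linear c0 (- (`|c1| + `|c2|)) c00.
exists (Num.min e 1) => [|t]; first by rewrite lt_min e0 ltr01.
rewrite lt_min => /and3P[t0 te t1]; apply: le_trans (eP t _) _; first by rewrite t0.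
have h1 : - (`|c1| * t) <= c1 * t by rewrite -mulNr ler_wpM2r // lerNl -normrN ler_norm.
have h2 : - (`|c2| * t ^+ 2) <= c2 * t ^+ 2.
  by rewrite -mulNr ler_wpM2r ?sqr_ge0 // lerNl -normrN ler_norm.
have h3 : `|c2| * t ^+ 2 <= `|c2| * t.
  by rewrite ler_wpM2l // expr2 ler_piMr // ltW.
by nra.
Qed.

Lemma quadratic_near0 (c1 c2 e : R) : 0 < e ->
  (forall t, 0 <= t < e -> 0 <= c1 * t + c2 * t ^+ 2) ->
  0 <= c1 /\ (c1 = 0 -> 0 <= c2).
Proof.
move=> e0 H; split.
  rewrite leNgt; apply/negP => c10.
  have c2n : 0 < `|c2| + 1 by rewrite ltr_wpDl.
  pose t := Num.min (e / 2%:R) (- c1 / (2%:R * (`|c2| + 1))).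
  have t0 : 0 < t by rewrite lt_min !divr_gt0 ?mulr_gt0 ?oppr_gt0 ?ltr0n.
  have te : t < e by rewrite gt_min; apply/orP; left; lra.
  have tc : t * (2%:R * (`|c2| + 1)) <= - c1.
    by rewrite -ler_pdivlMr ?mulr_gt0 ?ltr0n // ge_min lexx orbT.
  have := H t; rewrite te (ltW t0) => /(_ isT).
  have : c2 * t ^+ 2 <= `|c2| * t ^+ 2 by rewrite ler_wpM2r ?sqr_ge0 // ler_norm.
  have : 0 <= `|c2| by [].
  move: tc; move: (`|c2|) => d tc d0 h1 h2.
  have : 0 <= t * (c1 + d * t) by nra.
  rewrite pmulr_rge0 // => h3.
  have : 0 <= d * t by rewrite mulr_ge0 // ltW.
  by clearbody t; clear h1 h2 H c2n; nra.
have half : 0 <= e / 2%:R < e by apply/andP; split; lra.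
move=> c10; have := H _ half; rewrite c10 mul0r add0r pmulr_lge0 //.
by rewrite exprn_gt0 // divr_gt0.
Qed.

Lemma taylor0E s (f : {poly R}) t : (taylor0 s f).[t] = \sum_(i < s.+1) f`_i * t ^+ i.
Proof.
rewrite (horner_coef_wide _ (size_poly _ _)); apply: eq_bigr => i _.
rewrite coef_poly ltn_ord horner_coef0 coef_derivn addn0 ffactnn -[f`_i *+ _]mulr_natr mulfK //.
by rewrite pnatr_eq0 -lt0n fact_gt0.
Qed.

Lemma principal_minor1 (S : comNzRingType) n (X : 'M[S]_n) k :
  principal_minor X [set k] = X k k.
Proof.
have det1 m (Y : 'M[S]_m) i : m = 1%N -> \det Y = Y i i.
  by move=> m1; subst m; rewrite (ord1 i) det_mx11.
have k1 : (0 < #|[set k]|)%N by rewrite cards1.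
rewrite /principal_minor (det1 _ _ (Ordinal k1)) ?cards1 // mxE.
by have := enum_valP (Ordinal k1); rewrite inE => /eqP ->.
Qed.

Lemma det_mxsub_inj (S : comNzRingType) m n (f : 'I_m -> 'I_n) (X : 'M[S]_n) :
  m = n -> injective f -> \det (mxsub f f X) = \det X.
Proof.
move=> mn; subst m => f_inj.
have -> : mxsub f f X = row_perm (perm f_inj) (col_perm (perm f_inj) X).
  by apply/matrixP => i j; rewrite !mxE !permE.
rewrite row_permE col_permE !det_mulmx !det_perm odd_permV.
by rewrite mulrCA -expr2 sqrr_sign mulr1.
Qed.

Lemma principal_minorT (S : comNzRingType) n (X : 'M[S]_n) :
  principal_minor X [set: 'I_n] = \det X.
Proof.
apply: det_mxsub_inj; first by rewrite cardsT card_ord.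
by move=> x y; apply: enum_val_inj.
Qed.

Lemma set2_cases (I : {set 'I_2}) : I != set0 ->
  (exists k, I = [set k]) \/ I = [set: 'I_2].
Proof.
rewrite -card_gt0 => I0.
have := max_card (mem I); rewrite card_ord leq_eqVlt ltnS => /orP[/eqP I2|I1].
  by right; apply/eqP; rewrite eqEcard subsetT cardsT card_ord I2.
by left; apply/cards1P; rewrite eqn_leq I1.
Qed.

(** The coefficient of [t] in [\det (X + t dX)]. *)
Definition ddet X dX := X 0 0 * dX 1 1 + X 1 1 * dX 0 0 - 2%:R * X 0 1 * dX 0 1.

Definition locally_psd s X dX := exists2 e, 0 < e & forall t, 0 <= t < e ->
  forall I : {set 'I_2}, I != set0 ->
  0 <= (taylor0 s (principal_minor (perturb X dX) I)).[t].

Lemma taylor0_entry s X dX k t : (0 < s)%N ->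
  (taylor0 s (principal_minor (perturb X dX) [set k])).[t] = X k k + dX k k * t.
Proof.
case: s => // s _; rewrite taylor0E principal_minor1 !mxE.
rewrite !big_ord_recl big1 => [|i _]; rewrite !coefD !coefXM !coefC /=.
  by rewrite !addr0 !add0r expr0 expr1 mulr1.
by rewrite addr0 mul0r.
Qed.

Lemma taylor0_det s X dX t : s = 1%N \/ s = 2%N -> X^T = X -> dX^T = dX ->
  (taylor0 s (principal_minor (perturb X dX) setT)).[t] =
  \det X + ddet X dX * t + (if s == 2%N then \det dX else 0) * t ^+ 2.
Proof.
move=> s12 Xs dXs; have X10 : X 1 0 = X 0 1 by rewrite -[in LHS]Xs mxE.
have dX10 : dX 1 0 = dX 0 1 by rewrite -[in LHS]dXs mxE.
rewrite taylor0E principal_minorT.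
have -> : \det (perturb X dX) =
    (\det X)%:P + (ddet X dX)%:P * 'X + (\det dX)%:P * 'X^2.
  rewrite !det_mx2 !mxE /ddet X10 dX10 !(rmorphD, rmorphB, rmorphM, rmorph_nat) /=.
  by ring.
by case: s12 => ->; rewrite !big_ord_recl big_ord0 !coefE /=; ring.
Qed.

Lemma quad_formE X (x : 'cV[R]_2) : X^T = X ->
  (x^T *m X *m x) 0 0 =
  X 0 0 * x 0 0 ^+ 2 + 2%:R * X 0 1 * x 0 0 * x 1 0 + X 1 1 * x 1 0 ^+ 2.
Proof.
move=> Xs; have X10 : X 1 0 = X 0 1 by rewrite -[in LHS]Xs mxE.
have e0 : @lift 2 0 0 = 1 by apply/val_inj.
rewrite mxE !big_ord_recl big_ord0 !mxE !big_ord_recl !big_ord0 !mxE !e0 X10.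
by ring.
Qed.

Lemma psd2 X : psd X ->
  [/\ X 1 0 = X 0 1, 0 <= X 0 0, 0 <= X 1 1 & 0 <= \det X].
Proof.
move=> [Xs Xpsd]; have X10 : X 1 0 = X 0 1 by rewrite -[in LHS]Xs mxE.
have q y z : 0 <= X 0 0 * y ^+ 2 + 2%:R * X 0 1 * y * z + X 1 1 * z ^+ 2.
  have := Xpsd (\col_(i < 2) [:: y; z]`_i).
  by rewrite quad_formE // !mxE.
have X00 : 0 <= X 0 0 by have := q 1 0; rewrite !(expr1n, expr0n, mulr0, mulr1, addr0).
have X11 : 0 <= X 1 1 by have := q 0 1; rewrite !(expr1n, expr0n, mulr0, mul0r, mulr1, add0r).
split=> //; rewrite det_mx2 X10; move: X00; rewrite le_eqVlt => /predU1P[X00|X00].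
  (* For [X 0 0 = 0] this vector gives [0 <= - (X 1 1 + 2) * X 0 1 ^+ 2]. *)
  have := q (- (X 1 1 + 1)) (X 0 1); rewrite -X00; move: (X 0 1) (X 1 1) X11 => y z z0 h.
  suff -> : y = 0 by rewrite !mul0r subrr.
  apply/eqP; rewrite -sqrf_eq0 eq_le sqr_ge0 andbT.
  have := sqr_ge0 y; nra.
have := q (- X 0 1) (X 0 0).
rewrite (_ : _ + _ = X 0 0 * (X 0 0 * X 1 1 - X 0 1 * X 0 1)); last by ring.
by rewrite pmulr_rge0.
Qed.

(** Positive definiteness persists for small [t]; for a singular [X] the lowest
    nonzero Taylor coefficient of [det (X + t dX)] decides. The diagonal entries give no
    further condition: if [X k k = 0], then the entry off the diagonal is zero,
    so [ddet X dX] is [dX k k] times the other diagonal entry of [X], which is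
    positive unless [X = 0]. *)
Lemma locally_psdP s X dX : s = 1%N \/ s = 2%N ->
  psd X -> dX^T = dX -> (X = 0 -> dX = 0) ->
  locally_psd s X dX <->
  (\det X = 0 -> 0 <= ddet X dX /\ (s = 2%N -> ddet X dX = 0 -> 0 <= \det dX)).
Proof.
move=> s12 Xpsd dXs dX0; have [Xs _] := Xpsd.
have [X10 X00 X11 detX0] := psd2 Xpsd.
have s0 : (0 < s)%N by case: s12 => ->.
split=> [[e e0 eP] detX|detX].
  have := @quadratic_near0 (ddet X dX) (if s == 2%N then \det dX else 0) e e0.
  case=> [t te|d1 d2].
    have := eP t te setT; rewrite taylor0_det // detX add0r; apply.
    by rewrite -card_gt0 cardsT card_ord.
  by split=> // s2; move: d2; rewrite s2.
apply: near0_all => I.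
have [->|/set2_cases[[k ->]|->]] := eqVneq I set0; first by exists 1.
  have dXk : X k k = 0 -> 0 <= dX k k.
    move=> Xk; have XX : X 0 0 * X 1 1 = 0.
      by case/orP: (ord2P k) Xk => /eqP -> ->; rewrite ?mulr0 ?mul0r.
    have X01 : X 0 1 = 0.
      apply/eqP; rewrite -sqrf_eq0 eq_le sqr_ge0 andbT; move: detX0.
      by rewrite det_mx2 X10 XX sub0r oppr_ge0 -expr2.
    have [] : 0 <= ddet X dX /\ (s = 2%N -> ddet X dX = 0 -> 0 <= \det dX).
      by apply: detX; rewrite det_mx2 X10 XX X01 mulr0 subrr.
    rewrite /ddet X01 mulr0 mul0r subr0 => dd _.
    have [X0|X0] := eqVneq X 0; first by rewrite (dX0 X0) mxE.
    have other u v : 0 <= X v v -> 0 <= X v v * dX u u ->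
        (X v v = 0 -> X = 0) -> 0 <= dX u u.
      move=> Xv + vN; rewrite pmulr_rge0 // lt0r Xv andbT.
      by apply: contraNneq X0 => /vN ->.
    have Xe : X 0 0 = 0 -> X 1 1 = 0 -> X = 0.
      move=> x0 x1; apply/matrixP => i j; rewrite mxE.
      by case/orP: (ord2P i) => /eqP ->; case/orP: (ord2P j) => /eqP ->; rewrite ?X10.
    case/orP: (ord2P k) Xk => /eqP -> Xk; move: dd; rewrite Xk mul0r ?add0r ?addr0 => dd.
      by apply: other dd _ => // /(Xe Xk).
    by apply: other dd _ => // /Xe; apply.
  have Xk : 0 <= X k k by case/orP: (ord2P k) => /eqP ->.
  have [e e0 eP] := near0_quadratic Xk dXk (fun _ _ => lexx 0).
  exists e => // t te _; rewrite taylor0_entry //.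
  by have := eP t te; rewrite mul0r addr0.
have d2 : \det X = 0 -> ddet X dX = 0 -> 0 <= if s == 2%N then \det dX else 0.
  move=> d0 d1; case: (s =P 2%N) => // s2.
  by apply: (proj2 (detX d0)).
have [e e0 eP] := near0_quadratic detX0 (fun d0 => proj1 (detX d0)) d2.
by exists e => // t te _; rewrite taylor0_det //; apply: eP.
Qed.

End LocalConditions.

(** * The quartic and the quadratic form of a generator *)

Section Generators.
Variable R : realType.
Implicit Types (X dX : 'M[R]_2) (D : 'M[R]_3) (v : 'cV[R]_2).
Let r2 : R := Num.sqrt 2%:R.

Lemma r2M : r2 * r2 = 2%:R.
Proof. by rewrite -expr2 sqr_sqrtr. Qed.

(** The coefficients of the form
    [v |-> vec (v v^T) *m D *m (vec (perp v (perp v)^T))^T]. *)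
Definition motion_quartic D : {poly R} :=
  Poly [:: D 1 0; r2 * (D (inord 2) 0 - D 1 (inord 2));
           D 0 0 + D 1 1 - 2%:R * D (inord 2) (inord 2);
           r2 * (D (inord 2) 1 - D 0 (inord 2)); D 0 1].

Lemma vecE X : (vec X 0 0 = X 0 0) * (vec X 0 1 = X 1 1) * (vec X 0 (inord 2) = r2 * X 0 1).
Proof. by rewrite !mxE /= inordK. Qed.

Lemma sum3 (F : 'I_3 -> R) : \sum_i F i = F 0 + F 1 + F (inord 2).
Proof.
rewrite !big_ord_recl big_ord0 addr0 addrA; congr (_ + F _ + F _); apply/val_inj => //=.
by rewrite inordK.
Qed.

Lemma ord3P (i : 'I_3) : [|| i == 0, i == 1 | i == inord 2].
Proof. by rewrite -!val_eqE /= inordK //; case: i => [[|[|[]]]]. Qed.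

Lemma vec_eqE X dX D : vec dX = vec X *m D ->
  [/\ dX 0 0 = X 0 0 * D 0 0 + X 1 1 * D 1 0 + r2 * X 0 1 * D (inord 2) 0,
      dX 1 1 = X 0 0 * D 0 1 + X 1 1 * D 1 1 + r2 * X 0 1 * D (inord 2) 1 &
      r2 * dX 0 1 = X 0 0 * D 0 (inord 2) + X 1 1 * D 1 (inord 2)
                    + r2 * X 0 1 * D (inord 2) (inord 2)].
Proof.
by move=> /rowP e; split; [have := e 0 | have := e 1 | have := e (inord 2)];
  rewrite [in RHS]mxE sum3 !vecE.
Qed.

Lemma vvTE v i j : (v *m v^T) i j = v i 0 * v j 0.
Proof. by rewrite mxE big_ord_recl big_ord0 addr0 !mxE. Qed.

(** [ddet X dX] is the inner product of [dX] with the adjugate of [X], and the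
    adjugate of [v v^T] is [perp v (perp v)^T]. *)
Lemma ddet_rank1 dX D v : vec dX = vec (v *m v^T) *m D ->
  ddet (v *m v^T) dX = bform 4 (motion_quartic D) v.
Proof.
case/vec_eqE => e0 e1 e2.
rewrite /ddet -[2%:R]r2M e0 e1.
rewrite (_ : r2 * r2 * _ * dX 0 1 = r2 * (v *m v^T) 0 1 * (r2 * dX 0 1)); last by ring.
rewrite e2 !vvTE /bform !big_ord_recl big_ord0 !coef_Poly /=.
by ring: r2M.
Qed.

(** The factors [B j] move by [- D^T] instead of [D] (see [given_by_dual]).
    Transposition exchanges the roles of [v v^T] and [perp v (perp v)^T]. *)
Lemma motion_quartic_dual D v :
  bform 4 (motion_quartic (- D^T)) v = - bform 4 (motion_quartic D) (perp v).
Proof.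
rewrite /bform !big_ord_recl !big_ord0 !coef_Poly !mxE /=.
by ring.
Qed.

(** If [motion_quartic D = 0], then [dX = S X + X S^T] for a matrix [S], and these
    are the coefficients of [v |-> 2 * det2 v (S v)]. *)
Definition motion_quadratic D : {poly R} :=
  Poly [:: - (r2 * D 1 (inord 2)); D 1 1 - D 0 0; r2 * D 0 (inord 2)].

Lemma Poly_eq0_coef (l : seq R) k : Poly l = 0 -> l`_k = 0.
Proof. by move=> l0; rewrite -coef_Poly l0 coef0. Qed.

Lemma r2_neq0 : r2 != 0.
Proof. by rewrite sqrtr_eq0 -ltNge ltr0n. Qed.

Lemma motion_quartic0P D : motion_quartic D = 0 ->
  [/\ D 0 1 = 0, D 1 0 = 0, D (inord 2) 0 = D 1 (inord 2),
      D (inord 2) 1 = D 0 (inord 2) &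
      2%:R * D (inord 2) (inord 2) = D 0 0 + D 1 1].
Proof.
move=> q; have c k := Poly_eq0_coef k q.
have sub0 (x y : R) : r2 * (x - y) = 0 -> x = y.
  by move/eqP; rewrite mulf_eq0 (negbTE r2_neq0) subr_eq0 => /eqP.
split; [exact: (c 4)|exact: (c 0)|exact: (sub0 _ _ (c 1))|exact: (sub0 _ _ (c 3))|].
by apply/esym/eqP; rewrite -subr_eq0; apply/eqP/(c 2).
Qed.

Lemma motion_quartic_dual0 D : motion_quartic D = 0 -> motion_quartic (- D^T) = 0.
Proof.
case/motion_quartic0P => q01 q10 q20 q21 q22; apply/polyP => k; rewrite coef_Poly coef0.
case: k => [|[|[|[|[|k]]]]] /=; rewrite ?nth_nil // !mxE ?q01 ?q10 ?q20 ?q21;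
  rewrite ?oppr0 ?subrr ?mulr0 //.
by rewrite mulrN q22; ring.
Qed.

Lemma motion_quadratic_dual0 D :
  motion_quartic D = 0 -> motion_quadratic D = 0 -> motion_quadratic (- D^T) = 0.
Proof.
case/motion_quartic0P => _ _ q20 q21 _ sD; have c k := Poly_eq0_coef k sD.
apply/polyP => k; rewrite coef_Poly coef0.
have := c 0; have := c 1; have := c 2; rewrite /= => c2 c1 c0.
case: k => [|[|[|k]]] /=; rewrite ?nth_nil // !mxE ?q20 ?q21 ?mulrN ?opprK //.
by apply: oppr_inj; rewrite oppr0 -[RHS]c1; ring.
Qed.

(** Here [dX = w v^T + v w^T] with [w = S v], which has determinant
    [- (det2 v w) ^+ 2]. *)
Lemma det_rank1 dX D v : dX^T = dX -> vec dX = vec (v *m v^T) *m D -> motion_quartic D = 0 ->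
  4%:R * \det dX = - bform 2 (motion_quadratic D) v ^+ 2.
Proof.
move=> dXs /vec_eqE[e0 e1 e2] /motion_quartic0P[q01 q10 q20 q21 q22].
have dX10 : dX 1 0 = dX 0 1 by rewrite -[in LHS]dXs mxE.
rewrite det_mx2 dX10 mulrBr.
rewrite (_ : 4%:R * (dX 0 1 * dX 0 1) = 2%:R * ((r2 * dX 0 1) * (r2 * dX 0 1))); last first.
  by ring: r2M.
rewrite e2 e0 e1 !vvTE q01 q10 q20 q21 /bform !big_ord_recl big_ord0 !coef_Poly /=.
have -> : D (inord 2) (inord 2) = (D 0 0 + D 1 1) / 2%:R by rewrite -q22; field.
by field: r2M.
Qed.

End Generators.

(** * Motions in terms of their generators *)

Section Motions.
Variable R : realType.
Implicit Types (X Y dX : 'M[R]_2) (D : 'M[R]_3) (v : 'cV[R]_2).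

Lemma vvT_psd v : psd (v *m v^T).
Proof.
split=> [|x]; first by rewrite trmx_mul trmxK.
rewrite quad_formE ?trmx_mul ?trmxK // !vvTE.
by rewrite (_ : _ + _ = (v 0 0 * x 0 0 + v 1 0 * x 1 0) ^+ 2) ?sqr_ge0 //; ring.
Qed.

Lemma det_vvT v : \det (v *m v^T) = 0.
Proof. by rewrite det_mx2 !vvTE; ring. Qed.

Lemma psd_det0 X : psd X -> \det X = 0 -> exists v, X = v *m v^T.
Proof.
move=> Xpsd; have [X10 X00 X11 _] := psd2 Xpsd.
rewrite det_mx2 X10 => /eqP; rewrite subr_eq0 => /eqP detX.
have E (x y : R) : x * x = X 0 0 -> x * y = X 0 1 -> y * y = X 1 1 ->
    exists v, X = v *m v^T.
  move=> xx xy yy; exists (\col_(i < 2) [:: x; y]`_i); apply/matrixP => i j.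
  rewrite vvTE !mxE; case/orP: (ord2P i) => /eqP ->; case/orP: (ord2P j) => /eqP -> //=.
  by rewrite mulrC xy.
have [X0|X0] := eqVneq (X 0 0) 0.
  apply: (E 0 (Num.sqrt (X 1 1))); rewrite ?mul0r ?X0 //.
    by apply/esym/eqP; rewrite -sqrf_eq0 expr2 -detX X0 mul0r.
  by rewrite -expr2 sqr_sqrtr.
have r0 : Num.sqrt (X 0 0) != 0 by rewrite sqrtr_eq0 -ltNge lt0r X0.
have rr : Num.sqrt (X 0 0) * Num.sqrt (X 0 0) = X 0 0 by rewrite -expr2 sqr_sqrtr.
apply: (E _ (X 0 1 / Num.sqrt (X 0 0)) rr); first by rewrite mulrC divfK.
by rewrite mulf_div rr -detX mulrAC divff ?mul1r.
Qed.

Lemma rank_vvT v : v != 0 -> \rank (v *m v^T) = 1%N.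
Proof.
move=> v0; apply/eqP; rewrite eqn_leq (leq_trans (mxrankM_maxl _ _)) ?rank_leq_col //=.
rewrite lt0n mxrank_eq0; apply: contraNneq v0 => vv0.
have e i : v i 0 = 0.
  by apply/eqP; rewrite -[_ == 0](orbb) -mulf_eq0 -vvTE vv0 mxE.
by apply/eqP/cV2P; rewrite e mxE.
Qed.

Definition unvec (r : 'rV[R]_3) : 'M[R]_2 :=
  \matrix_(i, j) (if i != j then r 0 (inord 2) / Num.sqrt 2%:R
                  else if i == 0 then r 0 0 else r 0 1).

Lemma unvec_sym (r : 'rV[R]_3) : (unvec r)^T = unvec r.
Proof.
by apply/matrixP => i j; rewrite !mxE eq_sym; case: eqVneq => [->|].
Qed.

Lemma unvecK (r : 'rV[R]_3) : vec (unvec r) = r.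
Proof.
apply/rowP => k; case/or3P: (ord3P k) => /eqP ->; rewrite vecE !mxE //=.
by rewrite mulrC divfK // r2_neq0.
Qed.

Lemma vec_inj X Y : X^T = X -> Y^T = Y -> vec X = vec Y -> X = Y.
Proof.
move=> Xs Ys /rowP e.
have e2 : X 0 1 = Y 0 1.
  by apply: (mulfI (r2_neq0 R)); have := e (inord 2); rewrite !vecE.
apply/matrixP => i j.
case/orP: (ord2P i) => /eqP ->; case/orP: (ord2P j) => /eqP -> //.
- by have := e 0; rewrite !vecE.
- by rewrite -[X]Xs -[Y]Ys !mxE.
- by have := e 1; rewrite !vecE.
Qed.

Lemma vec0 : vec (0 : 'M[R]_2) = 0.
Proof. by apply/rowP => k; case/or3P: (ord3P k) => /eqP ->; rewrite vecE !mxE ?mulr0. Qed.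

Lemma inner_vec X Y : X^T = X -> Y^T = Y -> inner X Y = (vec X *m (vec Y)^T) 0 0.
Proof.
move=> Xs Ys; have X10 : X 1 0 = X 0 1 by rewrite -[in LHS]Xs mxE.
have Y10 : Y 1 0 = Y 0 1 by rewrite -[in LHS]Ys mxE.
have e0 : @lift 2 0 0 = 1 by apply/val_inj.
rewrite mxE sum3 ![(vec Y)^T _ _]mxE !vecE /inner /mxtrace !big_ord_recl big_ord0.
rewrite !mxE !big_ord_recl !big_ord0 !e0 X10 Y10.
by ring: (r2M R).
Qed.

Lemma locally_psd_gen s X dX D : s = 1%N \/ s = 2%N ->
  psd X -> dX^T = dX -> vec dX = vec X *m D ->
  locally_psd s X dX <->
  (forall v, X = v *m v^T -> 0 <= bform 4 (motion_quartic D) v /\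
    (s = 2%N -> bform 4 (motion_quartic D) v = 0 -> 0 <= \det dX)).
Proof.
move=> s12 Xpsd dXs gen; rewrite locally_psdP //; last first.
  move=> X0; apply: vec_inj; rewrite ?trmx0 //.
  by rewrite gen X0 vec0 mul0mx.
split=> [H v Xv|H detX].
  have := H; rewrite Xv det_vvT => /(_ erefl).
  by rewrite (ddet_rank1 (D := D)) // -Xv.
have [v Xv] := psd_det0 Xpsd detX.
by rewrite Xv (ddet_rank1 (D := D)) -?Xv //; apply: H.
Qed.

Lemma given_by_dual D (Y dY : 'M[R]_2) :
  (vec dY)^T = - (D *m (vec Y)^T) <-> vec dY = vec Y *m - D^T.
Proof.
rewrite mulmxN; split=> [e|->]; first by rewrite -[LHS]trmxK e linearN /= trmx_mul trmxK.
by rewrite linearN /= trmx_mul trmxK.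
Qed.

Lemma inf_motionP s p q (A dA : 'I_p -> 'M[R]_2) (B dB : 'I_q -> 'M[R]_2) :
  inf_motion s A B dA dB <->
  [/\ forall i, (dA i)^T = dA i, forall j, (dB j)^T = dB j,
      forall i j, inner (dA i) (B j) + inner (A i) (dB j) = 0,
      forall i, locally_psd s (A i) (dA i) & forall j, locally_psd s (B j) (dB j)].
Proof.
split=> [[dAs dBs AB [e e0 H]]|[dAs dBs AB lA lB]].
  by split=> // k; exists e => // t te I I0; have [] := H t te I I0.
split=> //.
have [e e0 eP] := near0_all lA; have [f f0 fP] := near0_all lB.
exists (Num.min e f); first by rewrite lt_min e0.
move=> t; rewrite lt_min => /and3P[t0 te tf] I I0.
by split=> k; [apply: eP | apply: fP]; rewrite ?t0.
Qed.

Lemma inf_motion_gen s p q (A dA : 'I_p -> 'M[R]_2) (B dB : 'I_q -> 'M[R]_2) D :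
  s = 1%N \/ s = 2%N -> (forall i, psd (A i)) -> (forall j, psd (B j)) ->
  (forall i, (dA i)^T = dA i) -> (forall j, (dB j)^T = dB j) -> given_by D A B dA dB ->
  inf_motion s A B dA dB <->
  (forall i v, A i = v *m v^T -> 0 <= bform 4 (motion_quartic D) v /\
    (s = 2%N -> bform 4 (motion_quartic D) v = 0 -> 0 <= \det (dA i))) /\
  (forall j v, B j = v *m v^T -> bform 4 (motion_quartic D) (perp v) <= 0 /\
    (s = 2%N -> bform 4 (motion_quartic D) (perp v) = 0 -> 0 <= \det (dB j))).
Proof.
move=> s12 Apsd Bpsd dAs dBs [gA gB].
have gB' j : vec (dB j) = vec (B j) *m - D^T by apply/given_by_dual.
have lA i := locally_psd_gen s12 (Apsd i) (dAs i) (gA i).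
have lB j := locally_psd_gen s12 (Bpsd j) (dBs j) (gB' j).
have lB' j : locally_psd s (B j) (dB j) <-> forall v, B j = v *m v^T ->
    bform 4 (motion_quartic D) (perp v) <= 0 /\
    (s = 2%N -> bform 4 (motion_quartic D) (perp v) = 0 -> 0 <= \det (dB j)).
  rewrite lB; split=> H v /H; rewrite motion_quartic_dual oppr_ge0 => -[H1 H2]; split=> // s2.
    by move=> q0; apply: H2 => //; rewrite q0 oppr0.
  by move/eqP; rewrite oppr_eq0 => /eqP; apply: H2.
rewrite inf_motionP; split=> [[_ _ _ HA HB]|[HA HB]].
  split=> k; [exact/lA/HA | exact/lB'/HB].
split=> //; [move=> i j|by move=> i; apply/lA/HA|by move=> j; apply/lB'/HB].
have [As _] := Apsd i; have [Bs _] := Bpsd j.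
have N (E : 'M[R]_1) : (- E) 0 0 = - E 0 0 by rewrite mxE.
by rewrite !inner_vec // gA gB mulmxN mulmxA N subrr.
Qed.

End Motions.

(** * Existence and uniqueness of generators; universal generators *)

Section Universal.
Variable R : realType.
Implicit Types (X Y dX : 'M[R]_2) (D : 'M[R]_3) (v : 'cV[R]_2).

(** Inner products of symmetric matrices are scalar products of their images under
    [vec], so a factorization of a rank 3 matrix is a rank factorization: both
    families of factors span the symmetric matrices. *)
Definition vecs n (A : 'I_n -> 'M[R]_2) : 'M[R]_(n, 3) := \matrix_(i < n) vec (A i).

Lemma factor_vecs p q (M : 'M[R]_(p, q)) (A : 'I_p -> 'M[R]_2) (B : 'I_q -> 'M[R]_2) :
  (forall i, (A i)^T = A i) -> (forall j, (B j)^T = B j) ->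
  (forall i j, M i j = inner (A i) (B j)) <-> M = vecs A *m (vecs B)^T.
Proof.
move=> As Bs.
have E i j : (vecs A *m (vecs B)^T) i j = inner (A i) (B j).
  rewrite inner_vec // !mxE; apply: eq_bigr => k _.
  by rewrite !mxE.
split=> [MAB|-> i j]; last exact: E.
by apply/matrixP => i j; rewrite E MAB.
Qed.

Lemma rank3_full p q (A : 'I_p -> 'M[R]_2) (B : 'I_q -> 'M[R]_2) :
  \rank (vecs A *m (vecs B)^T) = 3%N <-> row_full (vecs A) /\ row_full (vecs B).
Proof.
split=> [r3|[/eqP fA fB]]; last by rewrite mxrankMfree // /row_free mxrank_tr.
rewrite /row_full !eqn_leq !rank_leq_col -{1}r3 mxrankM_maxl; split=> //=.
by rewrite -mxrank_tr -{1}r3 mxrankM_maxr.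
Qed.

(** With a left inverse [L] of [vecs A], the only candidate is [L *m vecs dA];
    the motion equations make it compatible with both families. *)
Lemma generator_exists p q (M : 'M[R]_(p, q)) (A dA : 'I_p -> 'M[R]_2)
    (B dB : 'I_q -> 'M[R]_2) :
  \rank M = 3%N -> psd_factorization M A B ->
  (forall i, (dA i)^T = dA i) -> (forall j, (dB j)^T = dB j) ->
  (forall i j, inner (dA i) (B j) + inner (A i) (dB j) = 0) ->
  exists D, given_by D A B dA dB.
Proof.
move=> rM [Apsd Bpsd MAB] dAs dBs AB.
have As i : (A i)^T = A i by case: (Apsd i).
have Bs j : (B j)^T = B j by case: (Bpsd j).
move: rM; rewrite ((factor_vecs M As Bs).1 MAB) rank3_full => -[fA fB].
have [L LA] := row_fullP fA; have [K KB] := row_fullP fB.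
have BK : (vecs B)^T *m K^T = 1%:M by rewrite -trmx_mul KB trmx1.
have dAB : vecs dA *m (vecs B)^T = - (vecs A *m (vecs dB)^T).
  have mxN (E : 'M[R]_(p, q)) i j : (- E) i j = - E i j by rewrite mxE.
  apply/matrixP => i j; apply/eqP; rewrite mxN -addr_eq0.
  have E1 := (factor_vecs (vecs dA *m (vecs B)^T) dAs Bs).2 erefl i j.
  have E2 := (factor_vecs (vecs A *m (vecs dB)^T) As dBs).2 erefl i j.
  by rewrite E1 E2 AB.
pose D := L *m vecs dA.
have DB : D *m (vecs B)^T = - (vecs dB)^T.
  by rewrite -mulmxA dAB mulmxN mulmxA LA mul1mx.
have AD : vecs A *m D = vecs dA.
  by rewrite -[LHS]mulmx1 -BK mulmxA -[vecs A *m D *m _]mulmxA DB mulmxN -dAB -mulmxA BK mulmx1.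
exists D; split=> [i|j].
  by have /(congr1 (row i)) := AD; rewrite row_mul !rowK => <-.
have /(congr1 trmx) /(congr1 (row j)) := DB.
rewrite trmx_mul trmxK row_mul rowK linearN /= trmxK linearN /= rowK => e.
by apply/given_by_dual; rewrite mulmxN e opprK.
Qed.

Lemma generator_unique p q (M : 'M[R]_(p, q)) (A dA : 'I_p -> 'M[R]_2)
    (B dB : 'I_q -> 'M[R]_2) D D' :
  \rank M = 3%N -> psd_factorization M A B ->
  given_by D A B dA dB -> given_by D' A B dA dB -> D = D'.
Proof.
move=> rM [Apsd Bpsd MAB] [gA _] [gA' _].
have As i : (A i)^T = A i by case: (Apsd i).
have Bs j : (B j)^T = B j by case: (Bpsd j).
move: rM; rewrite ((factor_vecs M As Bs).1 MAB) rank3_full => -[fA _].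
have [L LA] := row_fullP fA.
rewrite -[D]mul1mx -[D']mul1mx -LA -!mulmxA; congr (_ *m _).
by apply/row_matrixP => i; rewrite !row_mul !rowK -gA gA'.
Qed.

Lemma psd_inner_ge0 X Y : psd X -> psd Y -> 0 <= inner X Y.
Proof.
move=> Xp Yp; have [Xs _] := Xp; have [Ys _] := Yp.
have [X10 X00 X11 dX] := psd2 Xp; have [Y10 Y00 Y11 dY] := psd2 Yp.
rewrite inner_vec // mxE sum3 ![(vec Y)^T _ _]mxE !vecE.
clear Xs Ys; move: dX dY; rewrite !det_mx2 X10 Y10 => dX dY.
rewrite (_ : _ + _ = X 0 0 * Y 0 0 + X 1 1 * Y 1 1 + 2%:R * (X 0 1 * Y 0 1)); last first.
  by ring: (r2M R).
have := mulr_ge0 X00 Y00; have := mulr_ge0 X11 Y11.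
have : (X 0 1 * Y 0 1) ^+ 2 <= (X 0 0 * Y 0 0) * (X 1 1 * Y 1 1).
  have : 0 <= (X 0 0 * X 1 1 - X 0 1 * X 0 1) * (Y 0 0 * Y 1 1) by rewrite !mulr_ge0.
  have : 0 <= (X 0 1 * X 0 1) * (Y 0 0 * Y 1 1 - Y 0 1 * Y 0 1).
    by rewrite mulr_ge0 // -expr2 sqr_ge0.
  by nra.
move: (X 0 0 * _) (X 1 1 * _) (X 0 1 * _); clear => x y z zxy y0 x0.
rewrite leNgt; apply/negP => neg.
have : 0 < (- (2%:R * z) - (x + y)) * (- (2%:R * z) + (x + y)) by apply: mulr_gt0; lra.
have := sqr_ge0 (x - y); nra.
Qed.

(** A factorization of size at most 1 has rank at most 1, so rank 3 forces the psd
    rank to be at least 2. *)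
Lemma in_M32_vecs p q (A : 'I_p -> 'M[R]_2) (B : 'I_q -> 'M[R]_2) :
  (forall i, psd (A i)) -> (forall j, psd (B j)) ->
  row_full (vecs A) -> row_full (vecs B) ->
  exists2 M : 'M[R]_(p, q), in_M32 M & psd_factorization M A B.
Proof.
move=> Apsd Bpsd fA fB; exists (\matrix_(i, j) inner (A i) (B j)); last first.
  by split=> // i j; rewrite mxE.
have As i : (A i)^T = A i by case: (Apsd i).
have Bs j : (B j)^T = B j by case: (Bpsd j).
set M := \matrix_(i, j) _.
have ME i j : M i j = inner (A i) (B j) by rewrite mxE.
have rM : \rank M = 3%N by rewrite ((factor_vecs M As Bs).1 ME); apply/rank3_full.
split=> //; first by move=> i j; rewrite ME psd_inner_ge0.
split=> [|l [A' [B' [_ _ ME']]]]; first by exists A, B.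
rewrite leqNgt; apply/negP => l2.
suff : (\rank M <= 1)%N by rewrite rM.
case: l l2 A' B' ME' => [|[|//]] _ A' B' ME'.
  rewrite (_ : M = 0) ?mxrank0 //; apply/matrixP => i j.
  by rewrite ME' /inner /mxtrace big_ord0 mxE.
rewrite (_ : M = (\col_i A' i 0 0) *m (\row_j B' j 0 0)).
  by rewrite (leq_trans (mxrankM_maxl _ _)) ?rank_leq_col.
by apply/matrixP => i j; rewrite ME' /inner /mxtrace !(mxE, big_ord_recl, big_ord0) !addr0.
Qed.

(** The squares of [v], [perp v] and [v + perp v] already span: a linear form on
    symmetric matrices is a binary quadratic form in [v] when restricted to the
    matrices [v v^T], and a quadratic form with three zeros is zero. *)
Lemma full_family n v : (2 < n)%N -> v != 0 ->
  exists C : 'I_n -> 'M[R]_2,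
    [/\ forall i, psd (C i), row_full (vecs C) & exists i, C i = v *m v^T].
Proof.
case: n => [|[|[|n]]] // _ v0.
pose w i : 'cV[R]_2 := nth (v + perp v) [:: v; perp v] i.
pose C (i : 'I_n.+3) := w i *m (w i)^T.
exists C; split=> [i||]; [exact: vvT_psd| |by exists 0].
rewrite /row_full -mxrank_tr; apply: inj_row_free => u uC.
pose k : {poly R} := Poly [:: u 0 1; Num.sqrt 2%:R * u 0 (inord 2); u 0 0].
have kE x : bform 2 k x = (u *m (vec (x *m x^T))^T) 0 0.
  rewrite mxE sum3 ![(vec _)^T _ _]mxE !vecE !vvTE /bform !big_ord_recl big_ord0 !coef_Poly /=.
  by ring.
have kw (i : nat) : (i < 3)%N -> bform 2 k (w i) = 0.
  move=> i3; have /matrixP/(_ 0 (widen_ord (isT : 3 <= n.+3)%N (Ordinal i3))) := uC.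
  by rewrite kE !mxE => {2}<-; apply: eq_bigr => j _; rewrite !mxE.
have vv : v 0 0 ^+ 2 + v 1 0 ^+ 2 != 0.
  apply: contra v0; rewrite paddr_eq0 ?sqr_ge0 // !sqrf_eq0 => /andP[/eqP v0 /eqP v1].
  by apply/eqP/cV2P; rewrite mxE.
have gp : gen_pos [:: v; perp v; v + perp v].
  have d12 : det2 v (perp v) = v 0 0 ^+ 2 + v 1 0 ^+ 2.
    by rewrite det2E !mxE /=; ring.
  have d13 : det2 v (v + perp v) = v 0 0 ^+ 2 + v 1 0 ^+ 2.
    by rewrite det2E !mxE /=; ring.
  have d23 : det2 (perp v) (v + perp v) = - (v 0 0 ^+ 2 + v 1 0 ^+ 2).
    by rewrite det2E !mxE /=; ring.
  by apply: gen_pos_pairwise => //=; rewrite d12 d13 d23 oppr_eq0 vv.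
have k0 : k = 0.
  have sk : (size k <= 3)%N by apply: size_Poly.
  apply: (bform_eq0 sk _ gp) => // x; rewrite !inE => /or3P[]/eqP ->.
  - exact: (kw 0).
  - exact: (kw 1).
  - exact: (kw 2).
have c i := Poly_eq0_coef i k0.
apply/rowP => i; rewrite mxE; case/or3P: (ord3P i) => /eqP ->.
- exact: (c 2).
- exact: (c 0).
by have /eqP := c 1; rewrite mulf_eq0 (negbTE (r2_neq0 R)) => /eqP.
Qed.

Definition on_line (k : nat) : 'cV[R]_2 := \col_(i < 2) [:: k%:R; 1]`_i.

Lemma on_line_gen_pos n : gen_pos (map on_line (iota 0 n.+2)).
Proof.
apply: gen_pos_pairwise; first by rewrite size_map size_iota.
rewrite pairwise_map; move: (iota_uniq 0 n.+2); rewrite uniq_pairwise.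
apply: sub_pairwise => i j; rewrite /= det2E !mxE /= mulr1 mulr1 subr_eq0.
by rewrite eqr_nat.
Qed.

Lemma bform_vanish n (k : {poly R}) : (size k <= n.+2)%N ->
  (forall v, v != 0 -> bform n.+1 k v = 0) -> k = 0.
Proof.
move=> sk k0; apply: (bform_eq0 sk _ (on_line_gen_pos n)) => [|v vs].
  by rewrite size_map size_iota.
by apply: k0; apply: contraTneq vs => ->; case: (on_line_gen_pos n).
Qed.

(** Any nonzero [v] can be put into the left family of a factorization, keeping
    [B], which gives [>= 0]; put into the right family, keeping [A], it gives
    [<= 0] at [perp v]. *)
Lemma universal_motion_quartic0 s p q (M : 'M[R]_(p, q))
    (A : 'I_p -> 'M[R]_2) (B : 'I_q -> 'M[R]_2) D : s = 1%N \/ s = 2%N ->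
  in_M32 M -> psd_factorization M A B -> universal s p q D -> motion_quartic D = 0.
Proof.
move=> s12 [_ rM _] [Apsd Bpsd MAB] uD.
have As i : (A i)^T = A i by case: (Apsd i).
have Bs j : (B j)^T = B j by case: (Bpsd j).
have p3 : (2 < p)%N by rewrite -rM rank_leq_row.
have q3 : (2 < q)%N by rewrite -rM rank_leq_col.
move: rM; rewrite ((factor_vecs M As Bs).1 MAB) rank3_full => -[fA fB].
have nonneg v : v != 0 -> 0 <= bform 4 (motion_quartic D) v.
  move=> v0; have [C [Cpsd fC [i Ci]]] := full_family p3 v0.
  have [M' M'in CB] := in_M32_vecs Cpsd Bpsd fC fB.
  have [dA [dB [gAB mot]]] := uD _ _ _ M'in CB.
  have [dAs dBs _ _] := mot.
  by have [/(_ i v Ci)[]] := (inf_motion_gen s12 Cpsd Bpsd dAs dBs gAB).1 mot.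
have nonpos v : v != 0 -> bform 4 (motion_quartic D) (perp v) <= 0.
  move=> v0; have [C [Cpsd fC [j Cj]]] := full_family q3 v0.
  have [M' M'in AC] := in_M32_vecs Apsd Cpsd fA fC.
  have [dA [dB [gAB mot]]] := uD _ _ _ M'in AC.
  have [dAs dBs _ _] := mot.
  by have [_ /(_ j v Cj)[]] := (inf_motion_gen s12 Apsd Cpsd dAs dBs gAB).1 mot.
apply: (@bform_vanish 3); first exact: size_Poly.
move=> v v0; apply/eqP; rewrite eq_le nonneg // andbT.
have -> : v = perp (- perp v) by apply: cV2P; rewrite !(mxE, perpE) /= ?opprK.
by apply: nonpos; rewrite oppr_eq0 perp_eq0.
Qed.

Lemma universal_of_motion_quartic0 s p q D : s = 1%N \/ s = 2%N ->
  motion_quartic D = 0 -> (s = 2%N -> motion_quadratic D = 0) -> universal s p q D.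
Proof.
move=> s12 D4 D2 M A B _ [Apsd Bpsd _].
exists (fun i => unvec (vec (A i) *m D)), (fun j => unvec (vec (B j) *m - D^T)).
have gAB : given_by D A B (fun i => unvec (vec (A i) *m D)) (fun j => unvec (vec (B j) *m - D^T)).
  by split=> [i|j]; [|apply/given_by_dual]; rewrite unvecK.
split=> //; apply/(inf_motion_gen s12 Apsd Bpsd (fun _ => unvec_sym _) (fun _ => unvec_sym _) gAB).
have det_ge0 X E v : X = v *m v^T -> motion_quartic E = 0 -> motion_quadratic E = 0 ->
    0 <= \det (unvec (vec X *m E)).
  move=> Xv E4 E2; rewrite -(@pmulr_rge0 _ 4%:R) ?ltr0n //.
  rewrite (det_rank1 (D := E) (v := v)) ?unvec_sym ?unvecK -?Xv //.
  by rewrite E2 bform0 expr0n oppr0.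
rewrite D4; split=> k v Xv; rewrite bform0; split=> // s2 _; apply: (det_ge0 _ _ v) => //.
- exact: D2.
- exact: motion_quartic_dual0.
- by apply: motion_quadratic_dual0 => //; apply: D2.
Qed.

End Universal.

(** * Construction of nontrivial motions *)

Section Rigidity.
Variable R : realType.
Implicit Types (X Y dX : 'M[R]_2) (D : 'M[R]_3) (v : 'cV[R]_2).

Lemma motion_quartic_surj (k : {poly R}) : (size k <= 5)%N -> exists D, motion_quartic D = k.
Proof.
move=> sk; pose r2 : R := Num.sqrt 2%:R.
pose rows := [:: [:: 0; k`_4; 0]; [:: k`_0; 0; 0]; [:: k`_1 / r2; k`_3 / r2; - k`_2 / 2%:R]].
exists (\matrix_(i < 3, j < 3) (nth [::] rows i)`_j); apply/polyP => n.
rewrite coef_Poly !mxE /= !inordK //=.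
have r0 := r2_neq0 R.
case: n => [|[|[|[|[|n]]]]] //=; last by rewrite nth_nil (leq_sizeP _ _ sk).
- by rewrite subr0 mulrC divfK.
- by field.
by rewrite subr0 mulrC divfK.
Qed.

(** With a positive coefficient at first order, the second order condition holds
    vacuously, so the same motion serves for [s = 1] and [s = 2]. *)
Lemma strict_inf_motion s p q (A : 'I_p -> 'M[R]_2) (B : 'I_q -> 'M[R]_2) D :
  s = 1%N \/ s = 2%N -> (forall i, psd (A i)) -> (forall j, psd (B j)) ->
  (forall i, \rank (A i) = 1%N ->
     exists2 a, A i = a *m a^T & 0 < bform 4 (motion_quartic D) a) ->
  (forall j, \rank (B j) = 1%N ->
     exists2 b, B j = b *m b^T & bform 4 (motion_quartic D) (perp b) < 0) ->
  exists dA dB, inf_motion s A B dA dB /\ given_by D A B dA dB.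
Proof.
move=> s12 Apsd Bpsd HA HB.
pose dA i := unvec (vec (A i) *m D); pose dB j := unvec (vec (B j) *m - D^T).
have gAB : given_by D A B dA dB.
  by split=> [i|j]; [|apply/given_by_dual]; rewrite unvecK.
exists dA, dB; split=> //.
have side X E : (\rank X = 1%N -> exists2 x, X = x *m x^T & 0 < bform 4 (motion_quartic E) x) ->
    forall v, X = v *m v^T -> 0 <= bform 4 (motion_quartic E) v /\
    (s = 2%N -> bform 4 (motion_quartic E) v = 0 -> 0 <= \det (unvec (vec X *m E))).
  move=> HX v Xv; have gX := unvecK (vec X *m E).
  have [v0|v0] := eqVneq v 0.
    have X0 : X = 0 by rewrite Xv v0 mul0mx.
    have dX0 : unvec (vec X *m E) = 0.
      by apply: vec_inj; rewrite ?unvec_sym ?trmx0 // gX X0 vec0 mul0mx.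
    rewrite -(ddet_rank1 (dX := 0)) ?dX0 -?Xv; last by rewrite X0 vec0 mul0mx.
    by rewrite det_mx2 /ddet !mxE !mulr0 !subr0 addr0.
  have [|x Xx x0] := HX; first by rewrite Xv rank_vvT.
  rewrite -(ddet_rank1 (dX := unvec (vec X *m E))) -Xv // Xx (ddet_rank1 (D := E)) -?Xx //.
  by split=> [|_ /eqP]; [exact: ltW|rewrite gt_eqF].
apply/(inf_motion_gen s12 Apsd Bpsd (fun _ => unvec_sym _) (fun _ => unvec_sym _) gAB).
split=> [i|j]; first exact: side (HA i).
move=> v Bv; have [|H1 H2] := side (B j) (- D^T) _ v Bv.
  by move=> /HB[b Bb b0]; exists b => //; rewrite motion_quartic_dual oppr_gt0.
move: H1 H2; rewrite motion_quartic_dual oppr_ge0 => H1 H2; split=> // s2 v0.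
by apply: H2 => //; rewrite v0 oppr0.
Qed.

Lemma bform_shear0 c (k : {poly R}) : (size k <= 5)%N ->
  (forall v, bform 4 k (shear c v) = 0) -> k = 0.
Proof.
move=> sk k0; apply: (@bform_vanish _ 3) => // v _.
rewrite (_ : v = shear c (shear (- c) v)) ?k0 //.
by apply: cV2P; rewrite !shearE //; ring.
Qed.

End Rigidity.

(** * The rigidity criterion *)

Definition projective_point (R : realType) (I J : Type) (a : I -> 'cV[R]_2)
    (b : J -> 'cV[R]_2) (k : I + J) :=
  match k with inl i => a i | inr j => perp (b j) end.

Definition is_inr (I J : Type) (k : I + J) := if k is inr _ then true else false.

(** Along an alternating chain of six points the two types take turns; the chain
    may start with either of them, hence the two cases of [slopes_interlaced]. *)
Lemma alternating_interlaced (R : realType) (I J : eqType) (c : R)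
    (a : I -> 'cV[R]_2) (b : J -> 'cV[R]_2) (x : I + J) (u : seq (I + J)) :
  size u = 5%N ->
  path (alternates (fun k => slope (shear c (projective_point a b k))) (@is_inr I J)) x u ->
  (forall k, k \in x :: u -> shear c (projective_point a b k) 1 0 != 0) ->
  exists (i1 i2 i3 : I) (j1 j2 j3 : J),
    [/\ {subset [:: inl i1; inl i2; inl i3; inr j1; inr j2; inr j3] <= x :: u},
        [/\ i1 <> i2, i1 <> i3 & i2 <> i3], [/\ j1 <> j2, j1 <> j3 & j2 <> j3] &
        interlaced (a i1) (a i2) (a i3) (b j1) (b j2) (b j3)].
Proof.
case: u => [|k1 [|k2 [|k3 [|k4 [|k5 [|? ?]]]]]] // _.
have neq_of_lt (K : eqType) (f : K -> R) k l : f k < f l -> k <> l.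
  by move=> kl e; rewrite e ltxx in kl.
rewrite /= andbT /alternates /=.
move=> /and5P[/andP[l01 s01] /andP[l12 s12] /andP[l23 s23] /andP[l34 s34] /andP[l45 s45]] yN.
have l02 := lt_trans l01 l12; have l24 := lt_trans l23 l34; have l13 := lt_trans l12 l23.
have l35 := lt_trans l34 l45; have l04 := lt_trans l02 l24; have l15 := lt_trans l13 l35.
have nI := neq_of_lt I (fun i => slope (shear c (a i))).
have nJ := neq_of_lt J (fun j => slope (shear c (perp (b j)))).
have sub (l r : seq (I + J)) : all [in r] l -> {subset l <= r} by move/allP.
destruct x as [i1|j1], k1 as [i2|j2] => //; destruct k2 as [i3|j3] => //;
  destruct k3 as [i4|j4] => //; destruct k4 as [i5|j5] => //; destruct k5 as [i6|j6] => //.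
- exists i1, i3, i5, j2, j4, j6; split.
  + by apply: sub; rewrite /= !inE !eqxx !orbT.
  + by split; apply: nI.
  + by split; apply: nJ.
  apply: (slopes_interlaced (c := c)); last by left; rewrite /= l01 l12 l23 l34 l45.
  apply/allP; rewrite /= ?(yN (inl i1)) ?(yN (inl i3)) ?(yN (inl i5)) //;
    by rewrite ?(yN (inr j2)) ?(yN (inr j4)) ?(yN (inr j6)) // !inE eqxx ?orbT.
exists i2, i4, i6, j1, j3, j5; split.
- by apply: sub; rewrite /= !inE !eqxx !orbT.
- by split; apply: nI.
- by split; apply: nJ.
apply: (slopes_interlaced (c := c)); last by right; rewrite /= l01 l12 l23 l34 l45.
apply/allP; rewrite /= ?(yN (inl i2)) ?(yN (inl i4)) ?(yN (inl i6)) //;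
  by rewrite ?(yN (inr j1)) ?(yN (inr j3)) ?(yN (inr j5)) // !inE eqxx ?orbT.
Qed.

Theorem theorem4 (R : realType) (p q : nat) (M : 'M[R]_(p, q))
  (A : 'I_p -> 'M[R]_2) (B : 'I_q -> 'M[R]_2)
  (a : 'I_p -> 'cV[R]_2) (b : 'I_q -> 'cV[R]_2)
  (hM : in_M32 M)
  (hAB : psd_factorization M A B)
  (ha : forall i, \rank (A i) = 1%N -> A i = a i *m (a i)^T)
  (hb : forall j, \rank (B j) = 1%N -> B j = b j *m (b j)^T)
  (haa : forall i i', \rank (A i) = 1%N -> \rank (A i') = 1%N ->
     i <> i' -> det2 (a i) (a i') <> 0)
  (hbb : forall j j', \rank (B j) = 1%N -> \rank (B j') = 1%N ->
     j <> j' -> det2 (b j) (b j') <> 0)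
  (hab : forall i j, \rank (A i) = 1%N -> \rank (B j) = 1%N ->
     dot (a i) (b j) <> 0) :
  forall s : nat, s = 1%N \/ s = 2%N ->
  (inf_rigid s A B <->
   exists (i1 i2 i3 : 'I_p) (j1 j2 j3 : 'I_q),
     [/\ \rank (A i1) = 1%N, \rank (A i2) = 1%N & \rank (A i3) = 1%N] /\
     [/\ \rank (B j1) = 1%N, \rank (B j2) = 1%N & \rank (B j3) = 1%N] /\
     [/\ i1 <> i2, i1 <> i3 & i2 <> i3] /\
     [/\ j1 <> j2, j1 <> j3 & j2 <> j3] /\
     [/\ 0 < (det2 (b j1) (b j3) * det2 (b j2) (b j3)
              * dot (a i2) (b j3) * dot (a i3) (b j3))
             / (det2 (a i1) (a i2) * det2 (a i1) (a i3)
                * dot (a i1) (b j1) * dot (a i1) (b j2)),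
         0 < - ((det2 (b j1) (b j3) * det2 (b j2) (b j3)
                 * dot (a i1) (b j3) * dot (a i3) (b j3))
                / (det2 (a i1) (a i2) * det2 (a i2) (a i3)
                   * dot (a i2) (b j1) * dot (a i2) (b j2))),
         0 < (det2 (b j1) (b j3) * det2 (b j2) (b j3)
              * dot (a i1) (b j3) * dot (a i2) (b j3))
             / (det2 (a i1) (a i3) * det2 (a i2) (a i3)
                * dot (a i3) (b j1) * dot (a i3) (b j2)),
         0 < (det2 (b j2) (b j3)
              * dot (a i1) (b j3) * dot (a i2) (b j3) * dot (a i3) (b j3))
             / (det2 (b j1) (b j2)
                * dot (a i1) (b j1) * dot (a i2) (b j1) * dot (a i3) (b j1))
       & 0 < - ((det2 (b j1) (b j3)
                 * dot (a i1) (b j3) * dot (a i2) (b j3) * dot (a i3) (b j3))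
                / (det2 (b j1) (b j2)
                   * dot (a i1) (b j2) * dot (a i2) (b j2) * dot (a i3) (b j2)))]).
Proof.
have [_ rM _] := hM; have [Apsd Bpsd MAB] := hAB.
have rank1 (X : 'M[R]_2) (v : 'cV[R]_2) : \rank X = 1%N -> X = v *m v^T -> v != 0.
  by move=> rX Xv; apply/eqP => v0; move: rX; rewrite Xv v0 mul0mx mxrank0.
move=> s s12; split=> [rigid|]; last first.
- move=> [i1 [i2 [i3 [j1 [j2 [j3 [[Ai1 Ai2 Ai3] [[Bj1 Bj2 Bj3] six]]]]]]]].
  have [[i12 i13 i23] [[j12 j13 j23] inter]] := six.
  move=> dA dB mot; have /inf_motionP[dAs dBs AB _ _] := mot.
  have [D gD] := generator_exists rM hAB dAs dBs AB.
  have [HA HB] := (inf_motion_gen s12 Apsd Bpsd dAs dBs gD).1 mot.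
  have D4 : motion_quartic D = 0.
    have qA i : \rank (A i) = 1%N -> 0 <= bform 4 (motion_quartic D) (a i).
      by move=> /ha /HA[].
    have qB j : \rank (B j) = 1%N -> bform 4 (motion_quartic D) (perp (b j)) <= 0.
      by move=> /hb /HB[].
    apply: (@interlaced_quartic_eq0 _ (motion_quartic D) (a i1) (a i2) (a i3) (b j1) (b j2) (b j3));
      rewrite ?qA ?qB ?size_Poly //.
    rewrite /= det2_perp !det2_perpr !andbT.
    by do !(apply/andP; split); apply/eqP; (exact: haa || exact: hbb || exact: hab).
  exists D; split=> //; apply: universal_of_motion_quartic0 => // s2.
  have qA i : \rank (A i) = 1%N -> bform 2 (motion_quadratic D) (a i) = 0.
    move=> ri; have [_ /(_ s2)] := HA i _ (ha i ri).
    rewrite D4 => /(_ _) detA.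
    have : 0 <= 4%:R * \det (dA i) by rewrite mulr_ge0 // detA // bform0.
    rewrite (det_rank1 (D := D) (v := a i)) -?ha //; last exact: gD.1.
    by rewrite oppr_ge0 => q0; apply/eqP; rewrite -sqrf_eq0 eq_le q0 sqr_ge0.
  have gp : gen_pos [:: a i1; a i2; a i3].
    apply: gen_pos_pairwise; rewrite //= !andbT.
    by do !(apply/andP; split); apply/eqP; exact: haa.
  apply: (@bform_eq0 _ 2 _ _ _ _ gp) => //; first exact: size_Poly.
  by move=> v; rewrite !inE => /or3P[]/eqP ->; apply: qA.
(* Necessity: the rank one factors as points of one projective line. *)
pose pt := projective_point a b; pose is_b := @is_inr 'I_p 'I_q.
pose rank_one (k : 'I_p + 'I_q) :=
  match k with inl i => \rank (A i) == 1%N | inr j => \rank (B j) == 1%N end.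
pose pts := filter rank_one (enum {: 'I_p + 'I_q}).
have ptsE k : (k \in pts) = rank_one k by rewrite mem_filter mem_enum andbT.
have det_pt : {in pts &, forall k l, k != l -> det2 (pt k) (pt l) != 0}.
  move=> k l; rewrite !ptsE; case: k => [i|j]; case: l => [i'|j'] /= /eqP rk /eqP rl kl.
  - by apply/eqP/haa => // e; rewrite e eqxx in kl.
  - by rewrite det2_perpr; apply/eqP/hab.
  - by rewrite det2C oppr_eq0 det2_perpr; apply/eqP/hab.
  - by rewrite det2_perp; apply/eqP/hbb => // e; rewrite e eqxx in kl.
have [c cP] : exists c, {in pts, forall k, shear c (pt k) 1 0 != 0}.
  have [|c cP] := @exists_shear _ (map pt pts).
    apply/negP => /mapP[k]; rewrite ptsE; case: k => [i|j] /= /eqP rk.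
      by move=> a0; have := rank1 _ _ rk (ha i rk); rewrite -a0 eqxx.
    by move=> b0; have := rank1 _ _ rk (hb j rk); rewrite -perp_eq0 -b0 eqxx.
  by exists c => k kp; apply: cP; apply: map_f.
have [] := @alternation_dichotomy _ _ (fun k => slope (shear c (pt k))) is_b 4 pts.
- by rewrite filter_uniq // enum_uniq.
- move=> k l kp lp e; apply/eqP/negPn/negP => /(det_pt _ _ kp lp).
  by rewrite (@det2_slope _ c) ?cP // e subrr mulr0 eqxx.
- move=> [x [u [su alt sub]]].
  have [i1 [i2 [i3 [j1 [j2 [j3 [six di dj inter]]]]]]] :=
    alternating_interlaced su alt (fun k ku => cP k (sub k ku)).
  have rk k : k \in [:: inl i1; inl i2; inl i3; inr j1; inr j2; inr j3] -> rank_one k.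
    by move=> /six/sub; rewrite ptsE.
  have rA i : inl i \in [:: inl i1; inl i2; inl i3; inr j1; inr j2; inr j3] ->
      \rank (A i) = 1%N by move/rk/eqP.
  have rB j : inr j \in [:: inl i1; inl i2; inl i3; inr j1; inr j2; inr j3] ->
      \rank (B j) = 1%N by move/rk/eqP.
  exists i1, i2, i3, j1, j2, j3.
  split; last split; last by split; last split.
    by split; apply: rA; rewrite !inE eqxx ?orbT.
  by split; apply: rB; rewrite !inE eqxx ?orbT.
move=> [k [sk k0 kP]].
have [Q sQ QE] := bform_shear c k.
have [D DQ] := motion_quartic_surj sQ.
have sign x : x \in pts -> 0 < (-1) ^+ is_b x * bform 4 (motion_quartic D) (pt x).
  move=> xp; have y0 := cP x xp.
  rewrite DQ QE bform_affine // mulrCA mulr_gt0 ?kP //.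
  by rewrite exprn_even_gt0.
have [||dA [dB [mot gD]]] := @strict_inf_motion _ s p q A B D s12 Apsd Bpsd.
- move=> i ri; exists (a i); first exact: ha.
  by have := sign (inl i); rewrite ptsE /= ri expr0 mul1r; apply.
- move=> j rj; exists (b j); first exact: hb.
  by have := sign (inr j); rewrite ptsE /= rj expr1 mulN1r oppr_gt0; apply.
have [D' [gD' uD']] := rigid _ _ mot.
have := universal_motion_quartic0 s12 hM hAB uD'.
rewrite -(generator_unique rM hAB gD gD') DQ => Q0.
case/eqP: k0; apply: (@bform_shear0 _ c) => // v.
by rewrite -QE Q0 bform0.
Qed.
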